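(* Let $(R,\Lambda)$ be a Noetherian algebra. Put $$\mathbb{T}_R(\Lambda):=\prod_{\mathfrak p\in\operatorname{Spec}R}\mathsf{tors}(\mathsf{fl}\,\Lambda_{\mathfrak p}),\qquad \mathbb{F}_R(\Lambda):=\prod_{\mathfrak p\in\operatorname{Spec}R}\mathsf{torf}(\mathsf{fl}\,\Lambda_{\mathfrak p}),$$ and let $\Phi_{\rm t}:\mathsf{tors}\,\Lambda\to\mathbb{T}_R(\Lambda)$ and $\Phi_{\rm f}:\mathsf{torf}\,\Lambda\to\mathbb{F}_R(\Lambda)$ both be given by $\mathcal{C}\mapsto(\mathcal{C}_{\mathfrak p}\cap\mathsf{fl}\,\Lambda_{\mathfrak p})_{\mathfrak p\in\operatorname{Spec}R}$. Let $(-)^{\perp}:\mathsf{tors}\,\Lambda\to\mathsf{torf}\,\Lambda$ be $\mathcal T\mapsto\mathcal T^{\perp}$ (perpendicular taken in $\mathsf{mod}\,\Lambda$) and let $(-)^{\perp}:\mathbb{T}_R(\Lambda)\to\mathbb{F}_R(\Lambda)$ be the map taking perpendiculars componentwise (the $\mathfrak p$-component taken in $\mathsf{fl}\,\Lambda_{\mathfrak p}$). Then these four maps are well defined and form a commutative square, that is, $\Phi_{\rm f}(\mathcal T^{\perp})=\Phi_{\rm t}(\mathcal T)^{\perp}$ for all $\mathcal T\in\mathsf{tors}\,\Lambda$. Moreover $\Phi_{\rm t}$ is an embedding of posets, $(-)^\perp:\mathsf{tors}\,\Lambda\to\mathsf{torf}\,\Lambda$ is an anti-embedding of posets, $\Phi_{\rm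 f}$ is an isomorphism of posets, and $(-)^\perp:\mathbb{T}_R(\Lambda)\to\mathbb{F}_R(\Lambda)$ is an anti-isomorphism of posets.
   Context: A Noetherian algebra $(R,\Lambda)$ is a commutative Noetherian ring $R$ with a (not necessarily commutative) $R$-algebra $\Lambda$ (a ring with a ring homomorphism from $R$ to the center of $\Lambda$) that is finitely generated as an $R$-module. Modules are left modules; $\mathsf{mod}\,\Lambda$ is the category of finitely generated $\Lambda$-modules and $\mathsf{fl}\,\Lambda$ the category of finite length $\Lambda$-modules. All subcategories are full and closed under isomorphisms. A torsion class (resp. torsionfree class) of an abelian category $\mathcal A$ is a subcategory (containing $0$) closed under extensions and factor objects (resp. extensions and subobjects); $\mathsf{tors}\,\mathcal A$ and $\mathsf{torf}\,\mathcal A$ are the sets of these, ordered by inclusion, and $\mathsf{tors}\,\Lambda:=\mathsf{tors}(\mathsf{mod}\,\Lambda)$, $\mathsf{torf}\,\Lambda:=\mathsf{torf}(\mathsf{mod}\,\Lambda)$. For $\mathfrak p\in\operatorname{Spec}R$, $\Lambda_{\mathfrak p}:=R_{\mathfrak p}\otimes_R\Lambda$, and for a subcategory $\mathcal C$ of $\mathsf{mod}\,\Lambda$, $\mathcal C_{\mathfrak p}:=\{X_{\mathfrak p}\mid X\in\mathcal C\}$, viewed as a subcategory of $\mathsf{mod}\,\Lambda_{\mathfrak p}$ (closed up under isomorphism). For a subcategory $\mathcal B$ of $\mathcal A$, $\mathcal B^{\perp}=\{X\in\mathcal A\mid \operatorname{Hom}_{\mathcal A}(B,X)=0\ \text{for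 all }B\in\mathcal B\}$. Products of posets carry the componentwise order. An embedding of posets is an order-preserving map $f$ such that $f(a)\le f(b)$ implies $a\le b$; anti-embeddings and anti-isomorphisms are the order-reversing versions. *)

(* Defs.v *)
From HB Require Import structures.
From mathcomp Require Import all_boot all_order all_algebra.
From mathcomp Require Import boolp.
From mathcomp Require Import ring.

Set Implicit Arguments.
Unset Strict Implicit.
Unset Printing Implicit Defensive.

Import GRing.Theory.

Local Open Scope ring_scope.
Local Open Scope quotient_scope.

(* The "pz" structures of MathComp are used throughout so that the zero ring
   is allowed, both for the base ring and for the algebra. *)

Record algebra (R : comPzRingType) := Algebra {
  alg_ring :> pzRingType;
  alg_map : {rmorphism R -> alg_ring};
  alg_central : forall r a, alg_map r * a = a * alg_map r }.

Section Modules.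
Variable A : pzRingType.
Implicit Types (M N X Y Z : lmodType A).

Definition fingen M : Prop :=
  exists (n : nat) (g : 'I_n -> M),
    forall x, exists c : 'I_n -> A, x = \sum_(i < n) c i *: g i.

(* N is a maximal proper submodule of N'; equivalently N' / N is simple. *)
Definition maximal_in M (N N' : {pred M}) : Prop :=
  [/\ {subset N <= N'}, ~ {subset N' <= N} &
      forall K : {pred M}, submod_closed K ->
        {subset N <= K} -> {subset K <= N'} -> K =i N \/ K =i N'].

(* Existence of a composition series. *)
Definition finite_length M : Prop :=
  exists (n : nat) (S : nat -> {pred M}),
    [/\ forall i, submod_closed (S i), S 0%N =i pred1 0, S n =i predT
      & forall i, (i < n)%N -> maximal_in (S i) (S i.+1)].

Definition isomorphic M N : Prop := exists f : {linear M -> N}, bijective f.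

Definition short_exact X Y Z (f : {linear X -> Y}) (g : {linear Y -> Z}) :=
  [/\ injective f, forall z, exists y, g y = z
    & forall y, g y = 0 <-> exists x, f x = y].

(* A full subcategory is the class of its objects.  Below, [AA] is an abelian
   category of modules, closed under submodules, factor modules and finite
   direct sums, so that its monomorphisms, epimorphisms and short exact
   sequences are those of the category of all modules. *)
Implicit Types AA B C : lmodType A -> Prop.

Definition subcategory AA C : Prop :=
  [/\ forall M, C M -> AA M,
      forall M N, isomorphic M N -> C M -> C N
    & forall M, (forall x : M, x = 0) -> C M].

Definition closed_under_extensions AA C : Prop :=
  forall X Y Z (f : {linear X -> Y}) (g : {linear Y -> Z}),
    AA Y -> short_exact f g -> C X -> C Z -> C Y.

Definition closed_under_factors AA C : Prop :=
  forall X Y (g : {linear X -> Y}),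
    AA Y -> (forall y, exists x, g x = y) -> C X -> C Y.

Definition closed_under_subobjects AA C : Prop :=
  forall X Y (f : {linear X -> Y}), AA X -> injective f -> C Y -> C X.

Definition tors AA C : Prop :=
  [/\ subcategory AA C, closed_under_extensions AA C
    & closed_under_factors AA C].

Definition torf AA C : Prop :=
  [/\ subcategory AA C, closed_under_extensions AA C
    & closed_under_subobjects AA C].

Definition perp AA B : lmodType A -> Prop := fun X =>
  AA X /\ forall M, B M -> forall f : {linear M -> X}, forall m, f m = 0.

Definition class_le C D : Prop := forall M, C M -> D M.

End Modules.

(* The ideals of R are the submodules of R^o. *)
Definition noetherian_ring (R : comPzRingType) : Prop :=
  forall I : {pred R^o}, submod_closed I ->
    exists (n : nat) (g : 'I_n -> R),
      forall x, x \in I <-> exists c : 'I_n -> R, x = \sum_(i < n) c i * g i.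

Definition module_finite (R : comPzRingType) (L : algebra R) : Prop :=
  exists (n : nat) (g : 'I_n -> L),
    forall x, exists c : 'I_n -> R, x = \sum_(i < n) alg_map L (c i) * g i.

Definition noetherian_algebra (R : comPzRingType) (L : algebra R) : Prop :=
  noetherian_ring R /\ module_finite L.

Record spec (R : comPzRingType) := Spec {
  spec_pred :> {pred R};
  spec_ideal : submod_closed (spec_pred : {pred R^o});
  spec_proper : 1 \notin spec_pred;
  spec_prime : forall a b,
    a * b \in spec_pred -> a \in spec_pred \/ b \in spec_pred }.

Section Denominators.
Variables (R : comPzRingType) (p : spec R).

Definition den : Type := {s : R | s \notin p}.

Definition den1 : den := exist (fun s => s \notin p) 1 (spec_proper p).

Lemma den_mul_subproof (s t : den) : sval s * sval t \notin p.
Proof.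
apply/negP => /(@spec_prime _ p)[] h.
- by move: (proj2_sig s); rewrite h.
- by move: (proj2_sig t); rewrite h.
Qed.

Definition den_mul (s t : den) : den :=
  exist (fun s => s \notin p) (sval s * sval t) (den_mul_subproof s t).

End Denominators.
Arguments den1 {R p}.

Section Localization.
Variables (R : comPzRingType) (L : algebra R) (p : spec R) (M : lmodType L).
Implicit Types (x y : M) (s t u : den p) (r : R).

Local Notation "r ** x" := (alg_map L r *: x) (at level 40, left associativity).

(* x / s and y / t agree iff u t x = u s y for some u outside p. *)
Definition frac_rel (a b : M * den p) : bool :=
  `[< exists u : den p,
        (sval u * sval b.2) ** a.1 = (sval u * sval a.2) ** b.1 >].

Lemma actA r r' x : r ** (r' ** x) = (r * r') ** x.
Proof. by rewrite scalerA rmorphM. Qed.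

Lemma frac_rel_equiv : equiv_class_of frac_rel.
Proof.
split.
- by move=> [x s]; apply/asboolP; exists den1.
- by move=> a b; apply/asboolP/asboolP => -[u h]; exists u.
- move=> [y t] [x s] [z w] /asboolP[u /= h] /asboolP[v /= k]; apply/asboolP => /=.
  exists (den_mul (den_mul u v) t) => /=.
  transitivity ((sval v * sval w) ** ((sval u * sval t) ** x)).
    by rewrite actA; congr (alg_map L _ *: _); ring.
  rewrite h actA.
  transitivity ((sval u * sval s) ** ((sval v * sval w) ** y)).
    by rewrite actA; congr (alg_map L _ *: _); ring.
  by rewrite k actA; congr (alg_map L _ *: _); ring.
Qed.

Canonical frac_equiv := EquivRelPack frac_rel_equiv.

Definition loc : Type := {eq_quot frac_rel}.
HB.instance Definition _ := Choice.on loc.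

Definition frac x s : loc := \pi_{eq_quot frac_rel} (x, s).

Lemma frac_eqP x s y t :
  frac x s = frac y t <->
  exists u : den p, (sval u * sval t) ** x = (sval u * sval s) ** y.
Proof.
split=> [/eqmodP/asboolP //|h]; exact/eqmodP/asboolP.
Qed.

Lemma fracP (z : loc) : exists x s, z = frac x s.
Proof.
case: (repr z : M * den p) (reprK z) => x s <-.
by exists x, s.
Qed.

Definition num (z : loc) : M := (repr z : M * den p).1.
Definition denom (z : loc) : den p := (repr z : M * den p).2.

Lemma fracK z : frac (num z) (denom z) = z.
Proof. by rewrite /frac -surjective_pairing; exact: reprK. Qed.

Lemma frac_cancel x s u : frac ((sval u) ** x) (den_mul u s) = frac x s.
Proof.
apply/frac_eqP; exists den1 => /=.
by rewrite actA; congr (alg_map L _ *: _); ring.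
Qed.

Definition loc_add (a b : loc) : loc :=
  frac (sval (denom b) ** num a + sval (denom a) ** num b)
       (den_mul (denom a) (denom b)).

Definition loc_opp (a : loc) : loc := frac (- num a) (denom a).

Lemma loc_addE x s y t :
  loc_add (frac x s) (frac y t) =
  frac (sval t ** x + sval s ** y) (den_mul s t).
Proof.
rewrite /loc_add.
have /frac_eqP[u h] := fracK (frac x s).
have /frac_eqP[v k] := fracK (frac y t).
move: (num _) (denom _) (num (frac y t)) (denom (frac y t)) h k => x' s' y' t' h k.
apply/frac_eqP; exists (den_mul u v) => /=.
rewrite !scalerDr !actA; congr (_ + _).
  transitivity ((sval v * sval t * sval t') ** ((sval u * sval s) ** x')).
    by rewrite actA; congr (alg_map L _ *: _); ring.
  by rewrite h actA; congr (alg_map L _ *: _); ring.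
transitivity ((sval u * sval s * sval s') ** ((sval v * sval t) ** y')).
  by rewrite actA; congr (alg_map L _ *: _); ring.
by rewrite k actA; congr (alg_map L _ *: _); ring.
Qed.

Lemma loc_oppE x s : loc_opp (frac x s) = frac (- x) s.
Proof.
have /frac_eqP[u h] := fracK (frac x s).
by apply/frac_eqP; exists u; rewrite !scalerN h.
Qed.

Lemma loc_addA : associative loc_add.
Proof.
move=> a b c; have [x [s ->]] := fracP a; have [y [t ->]] := fracP b.
have [z [w ->]] := fracP c; rewrite !loc_addE /=.
apply/frac_eqP; exists den1 => /=.
rewrite !scalerDr !actA !addrA.
by congr (_ + _ + _); congr (alg_map L _ *: _); ring.
Qed.

Lemma loc_addC : commutative loc_add.
Proof.
move=> a b; have [x [s ->]] := fracP a; have [y [t ->]] := fracP b.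
rewrite !loc_addE addrC; apply/frac_eqP; exists den1 => /=.
by congr (alg_map L _ *: _); ring.
Qed.

Lemma loc_add0 : left_id (frac 0 den1) loc_add.
Proof.
move=> a; have [x [s ->]] := fracP a; rewrite loc_addE scaler0 add0r.
exact: frac_cancel.
Qed.

Lemma loc_addN : left_inverse (frac 0 den1) loc_opp loc_add.
Proof.
move=> a; have [x [s ->]] := fracP a; rewrite loc_oppE loc_addE.
rewrite scalerN addNr; apply/frac_eqP; exists den1 => /=.
by rewrite !scaler0.
Qed.

HB.instance Definition _ :=
  GRing.isZmodule.Build loc loc_addA loc_addC loc_add0 loc_addN.

Lemma frac_add x s y t :
  frac x s + frac y t = frac (sval t ** x + sval s ** y) (den_mul s t).
Proof. exact: loc_addE. Qed.

Lemma frac_addl x y s : frac (x + y) s = frac x s + frac y s.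
Proof. by rewrite frac_add -scalerDr frac_cancel. Qed.

End Localization.
Arguments loc {R L} p M.

Section LocalRing.
Variables (R : comPzRingType) (L : algebra R) (p : spec R).

Definition loc_scale (M : lmodType L) (a : loc p L^o) (z : loc p M) : loc p M :=
  frac ((num a : L) *: num z) (den_mul (denom a) (denom z)).

Lemma scale_mapC (M : lmodType L) (r : R) (a : L) (x : M) :
  a *: (alg_map L r *: x) = alg_map L r *: (a *: x).
Proof. by rewrite !scalerA alg_central. Qed.

Lemma loc_scaleE (M : lmodType L) (a : L^o) s (x : M) t :
  loc_scale (frac a s) (frac x t) = frac ((a : L) *: x) (den_mul s t).
Proof.
rewrite /loc_scale.
have /frac_eqP[u h] := fracK (frac a s).
have /frac_eqP[v k] := fracK (frac x t).
move: (num _) (denom _) (num (frac x t)) (denom (frac x t)) h k => a' s' x' t' h k.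
apply/frac_eqP; exists (den_mul u v) => /=.
have E (b : L) r r' (y : M) :
    alg_map L (r * r') *: (b *: y) = (alg_map L r * b) *: (alg_map L r' *: y).
  by rewrite rmorphM -!scalerA (scale_mapC _ b).
transitivity ((alg_map L (sval u * sval s) * (a' : L)) *:
              (alg_map L (sval v * sval t) *: x')).
  by rewrite -E; congr (alg_map L _ *: _); ring.
have -> : alg_map L (sval u * sval s) * (a' : L) =
          alg_map L (sval u * sval s') * (a : L) by exact: h.
rewrite k -E.
by congr (alg_map L _ *: _); ring.
Qed.

Definition loc_ring : Type := loc p L^o.
HB.instance Definition _ := GRing.Zmodule.on loc_ring.

Definition loc_one : loc_ring := frac (1 : L^o) den1.
Definition loc_mul (a b : loc_ring) : loc_ring := loc_scale a b.

Section ModuleLaws.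
Variable M : lmodType L.

Lemma loc_scaleA (a b : loc_ring) (z : loc p M) :
  loc_scale a (loc_scale b z) = loc_scale (loc_mul a b) z.
Proof.
have [x [s ->]] := fracP a; have [y [t ->]] := fracP b; have [w [v ->]] := fracP z.
rewrite (loc_scaleE y) loc_scaleE /loc_mul (loc_scaleE x) loc_scaleE scalerA.
apply/frac_eqP; exists den1 => /=.
by congr (alg_map L _ *: _); ring.
Qed.

Lemma loc_scale1 : left_id loc_one (@loc_scale M).
Proof.
move=> z; have [w [v ->]] := fracP z; rewrite loc_scaleE scale1r.
by apply/frac_eqP; exists den1 => /=; rewrite !mul1r.
Qed.

Lemma loc_scaleDr : right_distributive (@loc_scale M) +%R.
Proof.
move=> a z z'.
have [x [s ->]] := fracP a; have [y [t ->]] := fracP z; have [w [v ->]] := fracP z'.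
rewrite frac_add loc_scaleE (loc_scaleE x s y) (loc_scaleE x s w) frac_add.
apply/frac_eqP; exists den1 => /=.
rewrite !scalerDr !(scale_mapC _ x) !actA.
by congr (_ + _); congr (alg_map L _ *: _); ring.
Qed.

Lemma loc_scaleDl (z : loc p M) :
  {morph (fun a : loc_ring => loc_scale a z) : a b / a + b}.
Proof.
move=> a b.
have [x [s ->]] := fracP a; have [y [t ->]] := fracP b; have [w [v ->]] := fracP z.
rewrite [frac x s + _]frac_add loc_scaleE (loc_scaleE x) (loc_scaleE y) frac_add.
apply/frac_eqP; exists den1 => /=.
rewrite scalerDl !scalerDr -!scalerA !actA.
by congr (_ + _); congr (alg_map L _ *: _); ring.
Qed.

End ModuleLaws.

Lemma loc_mulA : associative loc_mul.
Proof. exact: loc_scaleA. Qed.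

Lemma loc_mul1r : right_id loc_one loc_mul.
Proof.
move=> z; have [w [v ->]] := fracP z; rewrite /loc_mul loc_scaleE.
apply/frac_eqP; exists den1 => /=.
by rewrite [w *: _]mulr1 mulr1.
Qed.

Lemma loc_mulDl : left_distributive loc_mul +%R.
Proof. by move=> a b c; exact: loc_scaleDl. Qed.

HB.instance Definition _ :=
  GRing.Zmodule_isPzRing.Build loc_ring
    loc_mulA (@loc_scale1 L^o) loc_mul1r loc_mulDl (@loc_scaleDr L^o).

HB.instance Definition _ (M : lmodType L) :=
  GRing.Zmodule_isLmodule.Build loc_ring (loc p M)
    (@loc_scaleA M) (@loc_scale1 M) (@loc_scaleDr M) (@loc_scaleDl M).

End LocalRing.
Arguments loc_ring {R} L p.

Definition base_algebra (R : comPzRingType) : algebra R :=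
  @Algebra R R idfun (@mulrC R).

Definition base_frac (R : comPzRingType) (p : spec R) (r : R) (s : den p) :
    loc_ring (base_algebra R) p :=
  @frac R (base_algebra R) p (base_algebra R)^o r s.

(* The fractions with denominators outside p are the tensor product over R of
   the local ring R_p with M: the R-balanced biadditive maps out of R_p x M are
   the additive maps out of [loc p M], along (r / s, x) |-> r x / s. *)
Lemma loc_tensor (R : comPzRingType) (L : algebra R) (p : spec R)
    (M : lmodType L) (V : zmodType)
    (b : loc_ring (base_algebra R) p -> M -> V) :
  (forall q, {morph b q : x y / x + y}) ->
  (forall x, {morph b^~ x : q q' / q + q'}) ->
  (forall q r x, b (q * base_frac r den1) x = b q (alg_map L r *: x)) ->
  exists! g : loc p M -> V,
    {morph g : z w / z + w} /\
    forall r s x, g (frac (alg_map L r *: x) s) = b (base_frac r s) x.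
Proof.
move=> bDr bDl bal.
pose B := base_algebra R.
have fr (r : R) (s : den p) x :
    b (base_frac r s) x = b (base_frac 1 s) (alg_map L r *: x).
  rewrite -bal; congr (b _ x); apply: esym.
  apply: etrans (@loc_scaleE R B p B^o _ _ _ _) _.
  apply/(@frac_eqP R B); exists den1 => /=.
  rewrite /GRing.scale /=; ring.
have bcan (s u : den p) x :
    b (base_frac 1 (den_mul u s)) (alg_map L (sval u) *: x) =
    b (base_frac 1 s) x.
  rewrite -fr; congr (b _ x); apply/(@frac_eqP R B); exists den1 => /=.
  rewrite /GRing.scale /=; ring.
pose g (z : loc p M) := b (base_frac 1 (denom z)) (num z).
have gE x s : g (frac x s) = b (base_frac 1 s) x.
  rewrite /g; have /frac_eqP[u h] := fracK (frac x s).
  move: (num _) (denom _) h => x' s' h.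
  rewrite -(bcan s' (den_mul u s)) /= h -(bcan s (den_mul u s')) /=.
  congr (b _ _); apply/(@frac_eqP R B); exists den1 => /=.
  rewrite /GRing.scale /=; ring.
exists g; split.
  split=> [z w|r s x]; last by rewrite gE -fr.
  have [x [s ->]] := fracP z; have [y [t ->]] := fracP w.
  rewrite frac_add !gE bDr (bcan t s); congr (_ + _).
  rewrite -(bcan s t); congr (b _ _).
  apply/(@frac_eqP R B); exists den1 => /=.
  rewrite /GRing.scale /=; ring.
move=> g' [_ g'E]; apply: funext => z.
have [x [s ->]] := fracP z.
by rewrite gE -g'E rmorph1 scale1r.
Qed.

Section LocalizedClasses.
Variables (R : comPzRingType) (L : algebra R).

Definition loc_class (p : spec R) (C : lmodType L -> Prop) :
    lmodType (loc_ring L p) -> Prop :=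
  fun Y => exists X : lmodType L, C X /\ @isomorphic (loc_ring L p) (loc p X) Y.

Definition family : Type := forall p : spec R, lmodType (loc_ring L p) -> Prop.

Definition family_le (X Y : family) : Prop := forall p, class_le (X p) (Y p).

Definition TT (X : family) : Prop :=
  forall p, tors (@finite_length (loc_ring L p)) (X p).

Definition FF (X : family) : Prop :=
  forall p, torf (@finite_length (loc_ring L p)) (X p).

Definition Phi (C : lmodType L -> Prop) : family :=
  fun p Y => loc_class C Y /\ finite_length Y.

Definition family_perp (X : family) : family :=
  fun p => perp (@finite_length (loc_ring L p)) (X p).

End LocalizedClasses.

(* Posets are given as a predicate cutting out the elements together with an
   order relation on the ambient type. *)
Section Posets.
Variables (S T : Type) (D : S -> Prop) (E : T -> Prop).
Variables (leS : S -> S -> Prop) (leT : T -> T -> Prop) (f : S -> T).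

Definition maps_into : Prop := forall a, D a -> E (f a).

Definition order_embedding : Prop :=
  [/\ maps_into,
      forall a b, D a -> D b -> leS a b -> leT (f a) (f b)
    & forall a b, D a -> D b -> leT (f a) (f b) -> leS a b].

Definition order_anti_embedding : Prop :=
  [/\ maps_into,
      forall a b, D a -> D b -> leS a b -> leT (f b) (f a)
    & forall a b, D a -> D b -> leT (f b) (f a) -> leS a b].

Definition bijective_between : Prop :=
  [/\ maps_into,
      forall a b, D a -> D b -> f a = f b -> a = b
    & forall c, E c -> exists a, D a /\ f a = c].

Definition order_isomorphism : Prop := bijective_between /\ order_embedding.

Definition order_anti_isomorphism : Prop :=
  bijective_between /\ order_anti_embedding.

End Posets.

(* Main.v *)
(* Restriction of scalars along L -> L_p identifies L_p-modules with the L-modules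
   on which the denominators act bijectively, and turns membership in C_p into
   conditions on lattices: for a torsion class T, Y lies in T_p iff some X in T
   maps to Y with an image generating Y over L_p; for a torsionfree class F, a
   finitely generated Y lies in F_p iff every finitely generated L-submodule of Y
   lies in F.  Well-definedness of the maps and the commutativity of the square
   follow directly.

   A torsionfree class F of mod L is determined by its coprimary modules: if P is
   a maximal associated prime of X, then the submodule N of elements killed by a
   power of P is P-coprimary, and every q-coprimary submodule of X/N is zero or
   embeds in X, so Noetherian induction applies.  For K finitely generated and
   p-coprimary, K embeds in K_p, which has finite length, and K lies in F iff K_p
   lies in F_p; this gives the injectivity of Phi_f.  Conversely a family G comes
   from the class of those X all of whose p-coprimary submodules K have K_p in G_p.

   The maps T -> T^perp reflect the order because every object has a largest
   T-subobject; in fl L_p every torsionfree class is some T^perp because every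
   object has a smallest subobject with torsionfree quotient.  That Phi_t reflects
   the order then follows from the square. *)
From HB Require Import structures.
Require Import Defs.
From mathcomp Require Import all_boot all_order all_algebra.
From mathcomp Require Import boolp classical_sets.
Set Implicit Arguments.
Unset Strict Implicit.
Unset Printing Implicit Defensive.
Import GRing.Theory Defs.
Local Open Scope quotient_scope.
Local Open Scope classical_set_scope.
Local Open Scope ring_scope.

(** * Restriction of scalars, on an alias of the carrier so that both modules share their
    elements *)

Definition restr (A B : pzRingType) (f : {rmorphism A -> B}) (M : lmodType B) :
  Type := M.

Section Restriction.
Variables (A B : pzRingType) (f : {rmorphism A -> B}) (M : lmodType B).

HB.instance Definition _ := GRing.Zmodule.on (restr f M).

Definition restr_scale (a : A) (x : restr f M) : restr f M := f a *: (x : M).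

Lemma restr_scaleA a b x :
  restr_scale a (restr_scale b x) = restr_scale (a * b) x.
Proof. by rewrite /restr_scale scalerA rmorphM. Qed.

Lemma restr_scale1 : left_id 1 restr_scale.
Proof. by move=> x; rewrite /restr_scale rmorph1 scale1r. Qed.

Lemma restr_scaleDr : right_distributive restr_scale +%R.
Proof. by move=> a x y; rewrite /restr_scale scalerDr. Qed.

Lemma restr_scaleDl x : {morph restr_scale^~ x : a b / a + b}.
Proof. by move=> a b; rewrite /restr_scale rmorphD scalerDl. Qed.

HB.instance Definition _ := GRing.Zmodule_isLmodule.Build A (restr f M)
  restr_scaleA restr_scale1 restr_scaleDr restr_scaleDl.

End Restriction.

(** * Constructing linear maps by choosing preimages *)

Section LinearMaps.
Variable A : pzRingType.
Implicit Types M N P : lmodType A.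

Lemma linear_ex M N (h : M -> N) :
  (forall a x y, h (a *: x + y) = a *: h x + h y) ->
  exists h' : {linear M -> N}, h' =1 h.
Proof.
move=> H; pose m := GRing.isLinear.Build A M N *:%R h H.
by pose h' : {linear M -> N} := HB.pack h m; exists h'.
Qed.

Lemma linear_restr (B : pzRingType) (f : {rmorphism A -> B})
    (M N : lmodType B) (h : {linear M -> N}) :
  exists h' : {linear restr f M -> restr f N}, forall x : M, h' x = h x.
Proof.
have [|h' h'E] := @linear_ex (restr f M) (restr f N) h.
  by move=> a x y; exact: linearP.
by exists h'.
Qed.

Lemma linear_factor M N P (g : {linear M -> N}) (h : {linear M -> P}) :
  (forall y, exists x, g x = y) -> (forall x, g x = 0 -> h x = 0) ->
  exists k : {linear N -> P}, forall x, k (g x) = h x.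
Proof.
move=> gS gh; pose l y := sval (cid (gS y)).
have lK y : g (l y) = y by rewrite /l; case: cid.
have hE x : h (l (g x)) = h x.
  by apply/subr0_eq; rewrite -linearB gh // linearB lK subrr.
have [|k kE] := @linear_ex N P (h \o l).
  move=> a x y; rewrite /= -linearP; apply/subr0_eq.
  by rewrite -linearB gh // linearB linearP !lK subrr.
by exists k => x; rewrite kE /= hE.
Qed.

Lemma linear_lift M N P (f : {linear M -> N}) (h : {linear P -> N}) :
  injective f -> (forall x, exists y, f y = h x) ->
  exists k : {linear P -> M}, forall x, f (k x) = h x.
Proof.
move=> fI fh; pose l x := sval (cid (fh x)).
have lK x : f (l x) = h x by rewrite /l; case: cid.
have [|k kE] := @linear_ex P M l.
  by move=> a x y; apply: fI; rewrite linearP !lK linearP.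
by exists k => x; rewrite kE.
Qed.

Lemma linear_inj M N (f : {linear M -> N}) :
  (forall x, f x = 0 -> x = 0) -> injective f.
Proof.
by move=> f0 x y e; apply/subr0_eq/f0; rewrite linearB e subrr.
Qed.

Lemma linear_inj0 M N (f : {linear M -> N}) x : injective f -> f x = 0 -> x = 0.
Proof. by move=> fI e; apply: fI; rewrite linear0. Qed.

Lemma inj_surj_bij (S T : Type) (f : S -> T) :
  injective f -> (forall y, exists x, f x = y) -> bijective f.
Proof.
move=> fI fS; exists (fun y => sval (cid (fS y))) => [x|y].
  by case: cid => z /= /fI.
by case: cid.
Qed.

End LinearMaps.

(** * Submodules, quotients, images and kernels *)

Section Submodules.
Variable A : pzRingType.
Implicit Types M N P Q : lmodType A.

Definition submod M (W : set M) : Prop :=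
  W 0 /\ forall a x y, W x -> W y -> W (a *: x + y).

Lemma submodD M (W : set M) x y : submod W -> W x -> W y -> W (x + y).
Proof. by move=> [_ h] Wx Wy; rewrite -[x]scale1r; apply: h. Qed.

Lemma submodZ M (W : set M) a x : submod W -> W x -> W (a *: x).
Proof. by move=> [W0 h] Wx; rewrite -[_ *: _]addr0; apply: h. Qed.

Lemma submodN M (W : set M) x : submod W -> W x -> W (- x).
Proof. by move=> Wm Wx; rewrite -scaleN1r; apply: submodZ. Qed.

Lemma submodB M (W : set M) x y : submod W -> W x -> W y -> W (x - y).
Proof. by move=> Wm Wx Wy; apply: submodD => //; apply: submodN. Qed.

Lemma submod_pred M (W : {pred M}) :
  submod_closed W <-> submod [set` W].
Proof. by split=> -[W0 Wl]; split. Qed.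

Lemma submod_set0 M : submod [set (0 : M)].
Proof. by split=> // a x y -> ->; rewrite scaler0 addr0. Qed.

Lemma submod_setT M : submod [set: M].
Proof. by split. Qed.

Lemma submodI M (V W : set M) : submod V -> submod W -> submod (V `&` W).
Proof.
move=> [V0 Vl] [W0 Wl]; split=> // a x y [Vx Wx] [Vy Wy].
by split; [apply: Vl|apply: Wl].
Qed.

Lemma submod_add M (V W : set M) : submod V -> submod W ->
  submod [set x | exists v w, [/\ V v, W w & x = v + w]].
Proof.
move=> Vm Wm; split; first by exists 0, 0; rewrite addr0; split=> //; [case: Vm|case: Wm].
move=> a _ _ [v [w [Vv Ww ->]]] [v' [w' [Vv' Ww' ->]]].
exists (a *: v + v'), (a *: w + w'); split; [by apply Vm|by apply Wm|].
by rewrite scalerDr addrACA.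
Qed.

Lemma submod_preim M N (f : {linear M -> N}) (W : set N) :
  submod W -> submod (f @^-1` W).
Proof.
move=> [W0 Wl]; split; first by rewrite /preimage /= linear0.
by move=> a x y Wx Wy; rewrite /preimage /= linearP; apply: Wl.
Qed.

Lemma submod_image M N (f : {linear M -> N}) (W : set M) :
  submod W -> submod (f @` W).
Proof.
move=> [W0 Wl]; split; first by exists 0 => //; rewrite linear0.
move=> a _ _ [x Wx <-] [y Wy <-]; exists (a *: x + y); first exact: Wl.
by rewrite linearP.
Qed.

Section Sub.
Variables (M : lmodType A) (W : {pred M}) (hW : submod_closed W).
(** The closure proof is an argument so that the instance declared next can recover it from the
    predicate. *)
Definition subm_pred of submod_closed W : {pred M} := W.
HB.instance Definition _ := GRing.isSubmodClosed.Build A M (subm_pred hW) hW.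
Definition subm := {x : M | x \in subm_pred hW}.
HB.instance Definition _ := SubChoice.on subm.
HB.instance Definition _ := [SubChoice_isSubLmodule of subm by <:].
End Sub.

(** Below, submodules occur only as injective linear maps; the sigma type behind them stays
    hidden. *)
Lemma submodule_ex M (W : set M) : submod W ->
  exists (S : lmodType A) (f : {linear S -> M}),
    injective f /\ forall x, W x <-> exists y, f y = x.
Proof.
move=> Wm; have hW : submod_closed ((fun x => `[<W x>]) : {pred M}).
  case: Wm => W0 Wl; split; first exact/asboolP.
  by move=> a x y /asboolP Wx /asboolP Wy; apply/asboolP/Wl.
have [|f fE] := @linear_ex _ (subm hW) M val; first by move=> a x y; rewrite linearP.
exists (subm hW), f; split=> [x y|x]; first by rewrite !fE => /val_inj.
split=> [/asboolP Wx|[y <-]]; last by rewrite fE; case: y => y /= /asboolP.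
have Wx' : x \in subm_pred hW by [].
by exists (Sub x Wx'); rewrite fE SubK.
Qed.

Section Quotient.
Variables (M : lmodType A) (W : set M) (Wm : submod W).

Definition quo_rel_of of submod W : rel M := fun x y => `[<W (x - y)>].
Local Notation quo_rel := (quo_rel_of Wm).

Lemma quo_rel_equiv : equiv_class_of quo_rel.
Proof.
split=> [x|x y|y x z].
- by apply/asboolP; rewrite subrr; case: Wm.
- by apply/asboolP/asboolP => /(submodN Wm); rewrite opprB.
- move=> /asboolP h /asboolP k; apply/asboolP.
  by move: (submodD Wm h k); rewrite subrKA.
Qed.

Canonical quo_equiv := EquivRelPack quo_rel_equiv.

Definition quo : Type := {eq_quot quo_rel}.
HB.instance Definition _ := Choice.on quo.

Definition toquo (x : M) : quo := \pi_{eq_quot quo_rel} x.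

Lemma toquo_eq x y : toquo x = toquo y <-> W (x - y).
Proof. by split=> [/eqmodP/asboolP|h] //; apply/eqmodP/asboolP. Qed.

Definition unquo (z : quo) : M := repr z.

Lemma unquoK z : toquo (unquo z) = z.
Proof. exact: reprK. Qed.

Lemma unquo_toquo x : W (unquo (toquo x) - x).
Proof. exact/toquo_eq/unquoK. Qed.

Definition quo_add z w : quo := toquo (unquo z + unquo w).
Definition quo_opp z : quo := toquo (- unquo z).
Definition quo_scale a z : quo := toquo (a *: unquo z).

Lemma quo_addE x y : quo_add (toquo x) (toquo y) = toquo (x + y).
Proof.
by apply/toquo_eq; rewrite opprD addrACA; apply: submodD; rewrite //;
  exact: unquo_toquo.
Qed.

Lemma quo_oppE x : quo_opp (toquo x) = toquo (- x).
Proof.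
by apply/toquo_eq; rewrite -opprB opprK addrC; apply: submodN => //;
  exact: unquo_toquo.
Qed.

Lemma quo_scaleE a x : quo_scale a (toquo x) = toquo (a *: x).
Proof.
by apply/toquo_eq; rewrite -scalerBr; apply: submodZ => //; exact: unquo_toquo.
Qed.

Lemma quo_addA : associative quo_add.
Proof.
by move=> x y z; rewrite -(unquoK x) -(unquoK y) -(unquoK z) !quo_addE addrA.
Qed.

Lemma quo_addC : commutative quo_add.
Proof. by move=> x y; rewrite /quo_add addrC. Qed.

Lemma quo_add0 : left_id (toquo 0) quo_add.
Proof. by move=> x; rewrite -(unquoK x) quo_addE add0r. Qed.

Lemma quo_addN : left_inverse (toquo 0) quo_opp quo_add.
Proof. by move=> x; rewrite -(unquoK x) quo_oppE quo_addE addNr. Qed.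

HB.instance Definition _ :=
  GRing.isZmodule.Build quo quo_addA quo_addC quo_add0 quo_addN.

Lemma quo_scaleA a b x : quo_scale a (quo_scale b x) = quo_scale (a * b) x.
Proof. by rewrite -(unquoK x) !quo_scaleE scalerA. Qed.

Lemma quo_scale1 : left_id 1 quo_scale.
Proof. by move=> x; rewrite -(unquoK x) quo_scaleE scale1r. Qed.

Lemma quo_scaleDr : right_distributive quo_scale +%R.
Proof.
move=> a x y; rewrite -(unquoK x) -(unquoK y) [toquo _ + _]quo_addE !quo_scaleE.
by rewrite scalerDr; apply: esym; exact: quo_addE.
Qed.

Lemma quo_scaleDl x : {morph quo_scale^~ x : a b / a + b}.
Proof.
move=> a b; rewrite -(unquoK x) !quo_scaleE scalerDl.
by apply: esym; exact: quo_addE.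
Qed.

HB.instance Definition _ := GRing.Zmodule_isLmodule.Build A quo
  quo_scaleA quo_scale1 quo_scaleDr quo_scaleDl.

End Quotient.

Lemma quotient_ex M (W : set M) : submod W ->
  exists (Q : lmodType A) (g : {linear M -> Q}),
    (forall y, exists x, g x = y) /\ forall x, g x = 0 <-> W x.
Proof.
move=> Wm; have [|g gE] := @linear_ex _ M (quo Wm) (toquo Wm).
  move=> a x y; rewrite -[toquo Wm (_ + _)]quo_addE -[toquo Wm (_ *: _)]quo_scaleE.
  by [].
exists (quo Wm), g; split=> [y|x]; first by exists (unquo y); rewrite gE unquoK.
by rewrite gE -[0]/(toquo Wm 0) toquo_eq subr0.
Qed.

Lemma image_ex M N (h : {linear M -> N}) :
  exists (I : lmodType A) (p : {linear M -> I}) (i : {linear I -> N}),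
    [/\ forall y, exists x, p x = y, injective i & forall x, i (p x) = h x].
Proof.
have [I [i [iI iE]]] := submodule_ex (submod_image h (submod_setT M)).
have [x|p pE] := linear_lift (h := h) iI; first by apply/iE; exists x.
exists I, p, i; split=> // y.
have /iE[x _ e] : exists z, i z = i y by exists y.
by exists x; apply: iI; rewrite pE.
Qed.

Lemma kernel_ex M N (h : {linear M -> N}) :
  exists (K : lmodType A) (k : {linear K -> M}),
    injective k /\ forall x, h x = 0 <-> exists y, k y = x.
Proof. exact: submodule_ex (submod_preim h (submod_set0 N)). Qed.

Lemma short_exact_image M N P (f : {linear M -> N}) (g : {linear N -> P}) :
  injective f -> (forall y, g y = 0 <-> exists x, f x = y) ->
  exists (I : lmodType A) (p : {linear N -> I}) (i : {linear I -> P}),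
    [/\ short_exact f p, injective i & forall x, i (p x) = g x].
Proof.
move=> fI fg; have [I [p [i [pS iI pi]]]] := image_ex g.
exists I, p, i; split=> //; split=> // y; rewrite -fg -pi.
by split=> [->|/(linear_inj0 iI)]; rewrite ?linear0.
Qed.

Lemma zero_module_ex : exists Z : lmodType A, forall x : Z, x = 0.
Proof.
have [Z [f [fI fE]]] := submodule_ex (submod_set0 A^o).
exists Z => x; apply: (linear_inj0 fI); have /fE : exists y, f y = f x by exists x.
by [].
Qed.

Lemma isomorphic_sym M N : isomorphic M N -> isomorphic N M.
Proof.
case=> f fB; have [g fK gK] := fB; have fI := bij_inj fB.
have [|g' gE] := @linear_ex _ N M g.
  by move=> a x y; apply: fI; rewrite linearP !gK.
by exists g'; exists f => x; rewrite gE ?gK ?fK.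
Qed.

Lemma isomorphic_trans M N P :
  isomorphic M N -> isomorphic N P -> isomorphic M P.
Proof.
by move=> [f fB] [g gB]; exists (g \o f : {linear M -> P}); exact: bij_comp.
Qed.

Lemma isomorphic_refl M : isomorphic M M.
Proof. by exists idfun; exists id. Qed.

Lemma isomorphicP M N (f : {linear M -> N}) :
  injective f -> (forall y, exists x, f x = y) -> isomorphic M N.
Proof. by move=> fI fS; exists f; exact: inj_surj_bij. Qed.

End Submodules.

(** * Chain conditions for families of subsets *)

Section ChainConditions.
Variable T : Type.
Implicit Types (P C : set (set T)) (S W : set T).

(** The class [P] is arbitrary so that the notion also covers submodules over the base ring and the
    saturated sets below. *)
Definition has_max P : Prop := forall C, C !=set0 -> C `<=` P ->
  exists2 W, C W & forall W', C W' -> W `<=` W' -> W' `<=` W.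

Definition has_min P : Prop := forall C, C !=set0 -> C `<=` P ->
  exists2 W, C W & forall W', C W' -> W' `<=` W -> W `<=` W'.

Definition below S : set (set T) := [set W | W `<=` S].

End ChainConditions.

(** A maximal member of the image of [C] under [h] comes from a maximal member of [C], since
    inclusions within [P] can be tested after [h]. *)
Lemma has_max_inv (S T : Type) (P : set (set S)) (Q : set (set T))
    (h : set S -> set T) :
  (forall W, P W -> Q (h W)) ->
  (forall V W, V `<=` W -> h V `<=` h W) ->
  (forall V W, P V -> P W -> h V `<=` h W -> V `<=` W) ->
  has_max Q -> has_max P.
Proof.
move=> PQ hm hi Qmax C [W0 CW0] CP.
have [||_ [W CW <-] Wmax] := Qmax (h @` C).
- by exists (h W0), W0.
- by move=> _ [W CW <-]; apply/PQ/CP.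
exists W => // W' CW' sW; apply: hi; [exact: CP|exact: CP|].
by apply: Wmax; [exists W'|exact: hm].
Qed.

Lemma has_min_inv (S T : Type) (P : set (set S)) (Q : set (set T))
    (h : set S -> set T) :
  (forall W, P W -> Q (h W)) ->
  (forall V W, V `<=` W -> h V `<=` h W) ->
  (forall V W, P V -> P W -> h V `<=` h W -> V `<=` W) ->
  has_min Q -> has_min P.
Proof.
move=> PQ hm hi Qmin C [W0 CW0] CP.
have [||_ [W CW <-] Wmin] := Qmin (h @` C).
- by exists (h W0), W0.
- by move=> _ [W CW <-]; apply/PQ/CP.
exists W => // W' CW' sW; apply: hi; [exact: CP|exact: CP|].
by apply: Wmin; [exists W'|exact: hm].
Qed.

(** * Passing a chain condition through one simple step *)

Section ChainStep.
Variables (M : zmodType) (P : set (set M)) (S S' : set M).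
Hypotheses (PD : forall W, P W -> forall x y, W x -> W y -> W (x + y))
  (PB : forall W, P W -> forall x y, W x -> W y -> W (x - y))
  (PS : forall W, P W -> P (W `&` S))
  (stepS : forall W, P W -> W `<=` S' ->
     W `<=` S \/ forall x, S' x -> exists2 w, W w & S (x - w)).

(* The modular law. *)
Lemma chain_step_sub V W : P V -> P W -> V `<=` W -> W `<=` S' ->
  ~ V `<=` S -> W `&` S `<=` V `&` S -> W `<=` V.
Proof.
move=> PV PW sVW sWS' nV sI x Wx.
case: (stepS PV) => [|//|h]; first exact: subset_trans sWS'.
have [w Vw Sw] := h x (sWS' _ Wx).
rewrite -[x](subrK w); apply: (PD PV) => //.
by have [|] := sI (x - w); first by split=> //; apply: (PB PW) => //; exact: sVW.
Qed.

(** If members of [C] lie below [S], minimize among them. Otherwise minimize the intersections with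
    [S]; by the modular law they distinguish comparable members of [C]. *)
Lemma has_min_step : has_min (P `&` below S) -> has_min (P `&` below S').
Proof.
move=> hS C [W0 CW0] CP.
have [[W [CW sW]]|nC] := pselect (exists W, C W /\ W `<=` S).
  have [||V [CV sV] Vmin] := hS (C `&` below S).
  - by exists W.
  - by move=> V [/CP[PV _] sV].
  exists V => // V' CV' sV'; apply: Vmin => //; split=> //.
  exact: subset_trans sV.
have [||_ [V CV <-] Vmin] := hS [set W `&` S | W in C].
- by exists (W0 `&` S), W0.
- by move=> _ [V /CP[PV _] <-]; split; [exact: PS|move=> x []].
exists V => // V' CV' sV'.
have [PV sVS] := CP _ CV; have [PV' sVS'] := CP _ CV'.
apply: chain_step_sub => //; first by move=> sV'S; apply: nC; exists V'.
by apply: Vmin; [exists V'|apply: setSI].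
Qed.

Lemma has_max_step : has_max (P `&` below S) -> has_max (P `&` below S').
Proof.
move=> hS C [W0 CW0] CP.
have [[W [CW sW]]|nC] := pselect (exists W, C W /\ ~ W `<=` S); last first.
  have sC V : C V -> V `<=` S by move=> CV; apply: contrapT => sV; apply: nC; exists V.
  apply: hS; first by exists W0.
  by move=> V CV; split; [have [] := CP _ CV|exact: sC].
have [||_ [V [CV nV] <-] Vmax] := hS [set W `&` S | W in [set W | C W /\ ~ W `<=` S]].
- by exists (W `&` S), W.
- by move=> _ [V [/CP[PV _] _] <-]; split; [exact: PS|move=> x []].
exists V => // V' CV' sV'.
have [PV sVS] := CP _ CV; have [PV' sVS'] := CP _ CV'.
apply: chain_step_sub => //; apply: Vmax; last exact: setSI.
by exists V' => //; split=> // sV'S; apply: nV; exact: subset_trans sV'S.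
Qed.

End ChainStep.

(** * Finite length as both chain conditions together *)

Section FiniteLength.
Variable A : pzRingType.
Implicit Types M N : lmodType A.

Definition acc M : Prop := has_max (@submod A M).
Definition dcc M : Prop := has_min (@submod A M).

Lemma acc_sub M N (f : {linear M -> N}) : injective f -> acc N -> acc M.
Proof.
move=> fI; apply: (@has_max_inv _ _ _ _ (image ^~ f)).
- by move=> W; exact: submod_image.
- by move=> V W; exact: image_subset.
- by move=> V W _ _ h x Vx; have [|y Wy /fI <-] := h (f x); first exists x.
Qed.

Lemma dcc_sub M N (f : {linear M -> N}) : injective f -> dcc N -> dcc M.
Proof.
move=> fI; apply: (@has_min_inv _ _ _ _ (image ^~ f)).
- by move=> W; exact: submod_image.
- by move=> V W; exact: image_subset.
- by move=> V W _ _ h x Vx; have [|y Wy /fI <-] := h (f x); first exists x.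
Qed.

Lemma acc_quo M N (g : {linear M -> N}) :
  (forall y, exists x, g x = y) -> acc M -> acc N.
Proof.
move=> gS; apply: (@has_max_inv _ _ _ _ (preimage g)).
- by move=> W; exact: submod_preim.
- by move=> V W; exact: preimage_subset.
- by move=> V W _ _ h y Vy; have [x xy] := gS y; rewrite -xy; apply: h; rewrite /preimage /= xy.
Qed.

Lemma dcc_quo M N (g : {linear M -> N}) :
  (forall y, exists x, g x = y) -> dcc M -> dcc N.
Proof.
move=> gS; apply: (@has_min_inv _ _ _ _ (preimage g)).
- by move=> W; exact: submod_preim.
- by move=> V W; exact: preimage_subset.
- by move=> V W _ _ h y Vy; have [x xy] := gS y; rewrite -xy; apply: h; rewrite /preimage /= xy.
Qed.

(** Maximality is applied to the sum of [V] and [W]; the conclusion is the hypothesis [stepS] of the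
    simple step. *)
Lemma maximal_in_step M (V V' : {pred M}) (W : set M) :
  submod_closed V -> submod_closed V' -> maximal_in V V' ->
  submod W -> W `<=` [set` V'] ->
  W `<=` [set` V] \/ forall x, x \in V' -> exists2 w, W w & x - w \in V.
Proof.
move=> /submod_pred Vm /submod_pred Vm' [sV _ Vmax] Wm sW.
pose K : {pred M} := fun x =>
  `[< exists v w, [/\ v \in V, W w & x = v + w] >].
have [||x /asboolP[v [w [Vv Ww ->]]]|e|e] := Vmax K.
- apply/submod_pred; have [K0 Kl] := submod_add Vm Wm.
  split; first exact/asboolP.
  by move=> a x y /asboolP Kx /asboolP Ky; apply/asboolP/Kl.
- by move=> x Vx; apply/asboolP; exists x, 0; rewrite addr0; split=> //; case: Wm.
- exact: (submodD Vm' (sV _ Vv) (sW _ Ww)).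
- left=> x Wx /=; rewrite -e; apply/asboolP; exists 0, x; rewrite add0r.
  by split=> //; case: Vm.
- right=> x; rewrite -e => /asboolP[v [w [Vv Ww ->]]].
  by exists w; rewrite ?addrK.
Qed.

Lemma finite_length_chain M : finite_length M -> acc M /\ dcc M.
Proof.
move=> [n [S [Sm S0 Sn Smax]]].
pose P i := @submod A M `&` below [set` S i].
suff h i : (i <= n)%N -> has_max (P i) /\ has_min (P i).
  have [hM hm] := h n (leqnn n).
  by split=> C Cn CP; [apply: hM|apply: hm] => // W CW;
    split; [exact: CP|move=> x _ /=; rewrite Sn|exact: CP|move=> x _ /=; rewrite Sn].
elim: i => [_|i IH lt_in].
  have e W : P 0%N W -> W = [set 0].
    case=> -[W0 _] sW; apply/seteqP; split=> [x /sW /=|_ -> //].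
    by rewrite S0 inE => /eqP.
  by split=> C [W CW] CP; exists W => // V CV _;
    rewrite (e _ (CP _ CV)) (e _ (CP _ CW)).
have [hM hm] := IH (ltnW lt_in).
have PS W : submod W -> submod (W `&` [set` S i]).
  by move=> Wm; apply: submodI => //; exact/submod_pred/Sm.
have st W : submod W -> W `<=` [set` S i.+1] ->
    W `<=` [set` S i] \/ forall x, x \in S i.+1 -> exists2 w, W w & x - w \in S i.
  exact: (maximal_in_step (Sm _) (Sm _) (Smax _ lt_in)).
by split; [apply: has_max_step hM|apply: has_min_step hm] => //;
  move=> W Wm x y; do ?[exact: submodD|exact: submodB].
Qed.

(** The ascending condition gives a maximal submodule among those reached from zero by finitely many
    simple steps. If it were proper, the descending condition would give a minimal submodule
    strictly above it, hence one more step. *)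
Lemma chain_finite_length M : acc M -> dcc M -> finite_length M.
Proof.
move=> accM dccM.
pose chain n (S : nat -> {pred M}) := [/\ forall i, submod_closed (S i),
  S 0%N =i pred1 0 & forall i, (i < n)%N -> maximal_in (S i) (S i.+1)].
pose C (W : set M) := exists n S, chain n S /\ W = [set` S n].
have C0 : C [set 0].
  exists 0%N, (fun=> (pred1 0 : {pred M})).
  have e : [set` (pred1 0 : {pred M})] = [set 0].
    by apply/seteqP; split=> x /=; rewrite inE => /eqP.
  by split; rewrite ?e //; split=> // _; apply/submod_pred; rewrite e; exact: submod_set0.
have Cm : C `<=` @submod A M.
  by move=> _ [n [S [[Sm _ _] ->]]]; exact/submod_pred/Sm.
have [|_ [n [S [[Sm S0 Smax] ->]]] Wmax] := accM C _ Cm; first by exists [set 0].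
have [Sn|] := pselect (forall x, x \in S n).
  by exists n, S; split=> // x; rewrite Sn.
move=> nSn; exfalso.
pose D (W : set M) := [/\ submod W, [set` S n] `<=` W & ~ W `<=` [set` S n]].
have [||W [Wm sW nW] Wmin] := dccM D.
- exists setT; split; [exact: submod_setT|by []|].
  by move=> h; apply: nSn => x; exact: h.
- by move=> W [].
pose Wp : {pred M} := fun x => `[<W x>].
have WpE : [set` Wp] = W by apply/seteqP; split=> x /= => [/asboolP|Wx]; last exact/asboolP.
(* The new submodule is put at index [n.+1]; the later values matter only in that every term must be
   a submodule. *)
pose S' i := if (i <= n)%N then S i else Wp.
have Wpc : submod_closed Wp by apply/submod_pred; rewrite WpE.
have nW' := nW; apply: nW'; rewrite -WpE.
have -> : Wp = S' n.+1 by rewrite /S' ltnn.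
apply: Wmax; last by rewrite /S' ltnn WpE.
exists n.+1, S'; split=> //; split=> [i||i]; rewrite /S' //.
  by case: ifP.
rewrite ltnS => le_in; rewrite le_in; case: ltnP => [lt_in|le_ni]; first exact: Smax.
have -> : i = n by apply/eqP; rewrite eqn_leq le_in.
split=> [x Sx|sWS|K Km sSK sKW]; first exact/asboolP/sW.
  by apply: nW => x Wx; apply: sWS; exact/asboolP.
have [sKS|nKS] := pselect ([set` K] `<=` [set` S n]).
  by left=> x; apply/idP/idP; [exact: sKS|exact: sSK].
right=> x; apply/idP/idP; first exact: sKW.
have DK : D [set` K] by split=> //; exact/submod_pred.
by move=> /asboolP Wx; apply: (Wmin _ DK) => // y /sKW /asboolP.
Qed.

End FiniteLength.

(** * Spans, finite generation and Noetherian modules *)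

Section Span.
Variable A : pzRingType.
Implicit Types M N P : lmodType A.

(** Encoded as the intersection of all submodules containing [s], so that [lspan_min] acts as an
    induction principle. *)
Definition lspan M (s : seq M) : set M :=
  [set x | forall W, submod W -> (forall g, g \in s -> W g) -> W x].

Lemma submod_lspan M (s : seq M) : submod (lspan s).
Proof.
split=> [W [] //|a x y Sx Sy W Wm Ws].
by apply Wm; [exact: Sx|exact: Sy].
Qed.

Lemma mem_lspan M (s : seq M) g : g \in s -> lspan s g.
Proof. by move=> gs W _; apply. Qed.

Lemma lspan_min M (s : seq M) W :
  submod W -> (forall g, g \in s -> W g) -> lspan s `<=` W.
Proof. by move=> Wm Ws x; apply. Qed.

Lemma lspan_sub M (s t : seq M) : {subset s <= t} -> lspan s `<=` lspan t.
Proof.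
by move=> st; apply: lspan_min => [|g /st]; [exact: submod_lspan|exact: mem_lspan].
Qed.

Lemma lspan_nil M : lspan [::] `<=` [set (0 : M)].
Proof. by apply: lspan_min => //; exact: submod_set0. Qed.

Lemma lspan_cons M g (s : seq M) x :
  lspan (g :: s) x -> exists a y, lspan s y /\ x = a *: g + y.
Proof.
suff : lspan (g :: s) `<=` [set x | exists a y, lspan s y /\ x = a *: g + y] by apply.
apply: lspan_min; first split.
- by exists 0, 0; rewrite scale0r addr0; split=> //; case: (submod_lspan s).
- move=> a _ _ [b [y [Sy ->]]] [c [z [Sz ->]]].
  exists (a * b + c), (a *: y + z); split; first by apply submod_lspan.
  by rewrite scalerDl scalerDr scalerA addrACA.
- move=> h; rewrite inE => /predU1P[->|hs].
    by exists 1, 0; rewrite scale1r addr0; split=> //; case: (submod_lspan s).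
  by exists 0, h; rewrite scale0r add0r; split=> //; exact: mem_lspan.
Qed.

Lemma lspan_image M N (f : {linear M -> N}) (s : seq M) :
  f @` lspan s `<=` lspan (map f s).
Proof.
move=> _ [x Sx <-]; apply: (lspan_min (W := f @^-1` lspan (map f s)) _ _ Sx).
  by apply: submod_preim; exact: submod_lspan.
by move=> g gs; apply: mem_lspan; exact: map_f.
Qed.

Lemma submod_sum M (W : set M) (I : Type) (r : seq I) (F : I -> M) :
  submod W -> (forall i, W (F i)) -> W (\sum_(i <- r) F i).
Proof.
move=> Wm WF; apply: (big_ind W) => // [|x y]; first by case: Wm.
exact: submodD.
Qed.

Lemma fingenP M : fingen M <-> exists s : seq M, lspan s = setT.
Proof.
split=> [[n [g gE]]|[s sE]].
  exists [seq g i | i <- enum 'I_n]; apply/seteqP; split=> // x _.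
  have [c ->] := gE x; apply: (submod_sum (W := lspan _)); first exact: submod_lspan.
  move=> i; apply: (submodZ (W := lspan _)); first exact: submod_lspan.
  by apply: mem_lspan; apply: map_f; rewrite mem_enum.
exists (size s), (fun i : 'I_(size s) => nth 0 s i) => x.
have : lspan s x by rewrite sE.
apply: (@lspan_min _ s [set x | exists c : 'I_(size s) -> A,
  x = \sum_(i < size s) c i *: nth 0 s i]); first split.
- by exists (fun=> 0); rewrite big1 // => i _; rewrite scale0r.
- move=> a _ _ [c ->] [d ->]; exists (fun i => a * c i + d i).
  rewrite scaler_sumr -big_split; apply: eq_bigr => i _.
  by rewrite scalerDl scalerA.
- move=> g /(nthP 0)[i lt_is <-].
  exists (fun j : 'I_(size s) => if j == Ordinal lt_is then 1 else 0).
  rewrite (bigD1 (Ordinal lt_is)) //= eqxx scale1r big1 ?addr0 // => j /negPf->.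
  by rewrite scale0r.
Qed.

Definition noeth M : Prop :=
  forall W : set M, submod W -> exists s, W = lspan s.

Lemma acc_noeth M : acc M -> noeth M.
Proof.
move=> accM W Wm.
pose C := [set V | V `<=` W /\ exists s, V = lspan s].
have [||V [sW [s eV]] Vmax] := accM C.
- exists (lspan [::]); split; last by exists [::].
  by move=> x /lspan_nil ->; case: Wm.
- by move=> _ [_ [s ->]]; exact: submod_lspan.
exists s; rewrite -eV; apply/seteqP; split=> // x Wx.
apply: (Vmax (lspan (x :: s))); last by apply: mem_lspan; exact: mem_head.
  split; last by exists (x :: s).
  apply: lspan_min => // g; rewrite inE => /predU1P[-> //|gs].
  by apply: sW; rewrite eV; exact: mem_lspan.
by rewrite eV; apply: lspan_sub => g gs; rewrite inE gs orbT.
Qed.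

(** A family without maximal member yields, by choice, a strictly increasing sequence. Its union is
    finitely generated, so one term contains all the generators and the next term cannot be
    larger. *)
Lemma noeth_acc M : noeth M -> acc M.
Proof.
move=> nM C [W0 CW0] Cm; apply: contrapT => nmax.
have next (V : {W | C W}) : exists V' : {W | C W},
    sval V `<=` sval V' /\ ~ sval V' `<=` sval V.
  case: V => V CV /=; apply: contrapT => h; apply: nmax; exists V => // V' CV' sV.
  by apply: contrapT => nV'; apply: h; exists (exist _ V' CV').
have [f fE] := choice next.
pose S n := sval (iter n f (exist _ W0 CW0)).
have S_sub n m : (n <= m)%N -> S n `<=` S m.
  elim: m => [|m IH]; first by rewrite leqn0 => /eqP->.
  rewrite leq_eqVlt => /predU1P[-> //|/IH nm].
  apply: subset_trans nm _; exact: (fE _).1.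
have Sm n : submod (S n) by apply: Cm; exact: proj2_sig.
have [|s sE] := nM [set x | exists n, S n x].
  split; first by exists 0%N; exact: (Sm 0%N).1.
  move=> a x y [n Sx] [m Sy]; exists (maxn n m); apply: (Sm (maxn n m)).2.
    exact: S_sub (leq_maxl n m) _ Sx.
  exact: S_sub (leq_maxr n m) _ Sy.
have [m Sm'] : exists m : nat, forall g, g \in s -> S m g.
  have : forall g, g \in s -> exists n, S n g.
    by move=> g /mem_lspan; rewrite -sE.
  elim: (s) => [|g t IH] ht; first by exists 0%N.
  have [|m Sm'] := IH; first by move=> h hT; apply: ht; rewrite inE hT orbT.
  have [n Sg] := ht g (mem_head _ _); exists (maxn n m) => h.
  rewrite inE => /predU1P[->|/Sm' Sh]; first exact: S_sub (leq_maxl n m) _ Sg.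
  exact: S_sub (leq_maxr n m) _ Sh.
apply: (fE (iter m f (exist _ W0 CW0))).2; rewrite -/(S m) -/(S m.+1).
move=> x Sx; have : lspan s x by rewrite -sE; exists m.+1.
exact: lspan_min.
Qed.

Lemma noeth_fingen M : noeth M -> fingen M.
Proof.
by move=> nM; apply/fingenP; have [s sE] := nM _ (submod_setT M); exists s.
Qed.

(** Induction on the generators: the possible coefficients of [g] in elements of [W] form a finitely
    generated left ideal, and the elements of [W] in the span of [s] are covered by induction. *)
Lemma noeth_lspan M (s : seq M) (W : set M) :
  noeth A^o -> submod W -> W `<=` lspan s -> exists t, W = lspan t.
Proof.
move=> nA; elim: s W => [|g s IH] W Wm sW.
  exists [::]; apply/seteqP; split=> // x /lspan_nil ->; by case: Wm.
have gSm (V : set M) : submod V ->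
    submod [set a : A^o | exists y, lspan s y /\ V ((a : A) *: g + y)].
  move=> Vm; split.
    by exists 0; rewrite scale0r addr0; split; [case: (submod_lspan s)|case: Vm].
  move=> a b c [y [Sy Wy]] [z [Sz Wz]]; exists (a *: y + z); split.
    by apply submod_lspan.
  suff -> : ((a *: b + c) : A) *: g + (a *: y + z) = a *: ((b : A) *: g + y) + ((c : A) *: g + z).
    by apply Vm.
  by rewrite scalerDl scalerDr scalerA addrACA.
have [as' asE] := nA _ (gSm W Wm).
have [t tE] := IH (W `&` lspan s) (submodI Wm (submod_lspan s)) (@subIsetr _ _ _).
have [w wE] : exists w : A^o -> M, forall a, a \in as' ->
    W (w a) /\ exists y, lspan s y /\ w a = (a : A) *: g + y.
  have : forall a : A^o, exists w : M, a \in as' ->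
      W w /\ exists y, lspan s y /\ w = (a : A) *: g + y.
    move=> a; have [/mem_lspan|] := boolP (a \in as'); last by exists 0.
    by rewrite -asE => -[y [Sy Wy]]; exists ((a : A) *: g + y) => _; split=> //; exists y.
  by move=> /choice[w wE]; exists w.
exists (map w as' ++ t); apply/seteqP; split=> [x Wx|].
  have [a [y [Sy xE]]] := lspan_cons (sW _ Wx).
  have : lspan as' a by rewrite -asE; exists y; rewrite -xE.
  (* The coefficient ideal of the span of the lifts [map w as'] contains [as'], hence [a]. So some
     [a *: g + z] lies in that span, and [x] differs from it by an element of [W] in the span of
     [s]. *)
  move=> /(_ _ (gSm _ (submod_lspan (map w as'))))[b bs|z [Sz Wz]].
    have [_ [z [Sz wE']]] := wE b bs; exists z; split=> //.
    by rewrite -wE'; apply: mem_lspan; exact: map_f.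
  rewrite -[x](subrK (a *: g + z)) addrC; apply: (submodD (W := lspan _)); first exact: submod_lspan.
    by apply: lspan_sub Wz => h hw; rewrite mem_cat hw.
  have : lspan t (x - (a *: g + z)).
    rewrite -tE; split; last first.
      rewrite xE opprD addrACA subrr add0r; by apply: (submodB (W := lspan s)) => //; exact: submod_lspan.
    apply: submodB => //; apply: lspan_min Wz => // _ /mapP[b bs ->].
    by case: (wE b bs).
  by apply: lspan_sub => h ht; rewrite mem_cat ht orbT.
apply: lspan_min => // h; rewrite mem_cat => /orP[/mapP[b bs ->]|/mem_lspan].
  by case: (wE b bs).
by rewrite -tE => -[].
Qed.

Lemma fingen_noeth M : noeth A^o -> fingen M -> noeth M.
Proof.
by move=> nA /fingenP[s sE] W Wm; apply: (noeth_lspan (s := s) nA Wm); rewrite sE.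
Qed.

Lemma fingen_quo M N (g : {linear M -> N}) :
  (forall y, exists x, g x = y) -> fingen M -> fingen N.
Proof.
move=> gS /fingenP[s sE]; apply/fingenP; exists (map g s).
apply/seteqP; split=> // y _; have [x <-] := gS y.
by apply: lspan_image; exists x; rewrite // sE.
Qed.

Lemma fingen_iso M N : isomorphic M N -> fingen M -> fingen N.
Proof.
by move=> [f [g fK gK]]; apply: (fingen_quo (g := f)) => y; exists (g y).
Qed.

Lemma fingen_ext M N P (f : {linear M -> N}) (g : {linear N -> P}) :
  short_exact f g -> fingen M -> fingen P -> fingen N.
Proof.
move=> [_ gS ker_g] /fingenP[s sE] /fingenP[t tE].
have [l lK] := choice gS.
have gl : map g (map l t) = t.
  by rewrite -map_comp -[RHS]map_id; apply: eq_map => z; exact: lK.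
apply/fingenP; exists (map f s ++ map l t); apply/seteqP; split=> // y _.
have [u Su ue] : exists2 u, lspan (map l t) u & g u = g y.
  have : lspan t (g y) by rewrite tE.
  apply: (lspan_min (W := g @` lspan (map l t))).
    exact: submod_image (submod_lspan _).
  by move=> h ht; exists (l h); [apply: mem_lspan; exact: map_f|exact: lK].
have /ker_g[x xE] : g (y - u) = 0 by rewrite linearB ue subrr.
rewrite -[y](subrK u) -xE; apply: (submodD (W := lspan _)); first exact: submod_lspan.
  apply: (@lspan_sub _ (map f s)); first by move=> h hs; rewrite mem_cat hs.
  by apply: lspan_image; exists x; rewrite // sE.
by apply: lspan_sub Su => h hs; rewrite mem_cat hs orbT.
Qed.

Lemma fingen_acc M N (f : {linear M -> N}) : injective f -> acc N -> fingen M.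
Proof. by move=> fI accN; exact: noeth_fingen (acc_noeth (acc_sub fI accN)). Qed.

Lemma fingen_range M N (f : {linear M -> N}) (s : seq N) :
  injective f -> range f = lspan s -> fingen M.
Proof.
move=> fI fs; have [t ft] : exists t, map f t = s.
  have : forall g, g \in s -> exists x, f x = g.
    by move=> g /mem_lspan; rewrite -fs => -[x _ <-]; exists x.
  elim: (s) => [|g r IH] h; first by exists [::].
  have [|t <-] := IH; first by move=> k kr; apply: h; rewrite inE kr orbT.
  by have [x <-] := h g (mem_head _ _); exists (x :: t).
apply/fingenP; exists t; apply/seteqP; split=> // x _.
have : lspan (map f t) (f x) by rewrite ft -fs; exists x.
move=> /(lspan_min (submod_image f (submod_lspan t))) [|y ty /fI <- //].
by move=> _ /mapP[y yt ->]; exists y => //; exact: mem_lspan.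
Qed.

Lemma fingen_zero M : (forall x : M, x = 0) -> fingen M.
Proof.
move=> M0; apply/fingenP; exists [::]; apply/seteqP; split=> // x _.
by rewrite (M0 x); case: (submod_lspan ([::] : seq M)).
Qed.

Lemma finite_length_sub M N (f : {linear M -> N}) :
  injective f -> finite_length N -> finite_length M.
Proof.
move=> fI /finite_length_chain[aN dN].
by apply: chain_finite_length; [exact: acc_sub fI aN|exact: dcc_sub fI dN].
Qed.

Lemma finite_length_quo M N (g : {linear M -> N}) :
  (forall y, exists x, g x = y) -> finite_length M -> finite_length N.
Proof.
move=> gS /finite_length_chain[aM dM].
by apply: chain_finite_length; [exact: acc_quo gS aM|exact: dcc_quo gS dM].
Qed.

Lemma finite_length_iso M N : isomorphic M N -> finite_length M -> finite_length N.
Proof.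
by move=> [f [g fK gK]]; apply: (finite_length_quo (g := f)) => y; exists (g y).
Qed.

Lemma finite_length_fingen M : finite_length M -> fingen M.
Proof. by move=> /finite_length_chain[aM _]; exact: noeth_fingen (acc_noeth aM). Qed.

Lemma finite_length_zero M : (forall x : M, x = 0) -> finite_length M.
Proof.
move=> M0; apply: chain_finite_length => C [W CW] CP; exists W => // V CV _ x _.
  by rewrite (M0 x); case: (CP _ CW).
by rewrite (M0 x); case: (CP _ CV).
Qed.

End Span.

(** * Torsion pairs in a category of modules closed under submodules and factors *)

Section TorsionPairs.
Variables (A : pzRingType) (AA : lmodType A -> Prop).
Implicit Types (M N X Y Z : lmodType A) (B C T F : lmodType A -> Prop).
Hypotheses (AA_sub : forall M N (f : {linear M -> N}),
    injective f -> AA N -> AA M)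
  (AA_quo : forall M N (g : {linear M -> N}),
    (forall y, exists x, g x = y) -> AA M -> AA N)
  (AA_zero : forall M, (forall x : M, x = 0) -> AA M).

Lemma AA_iso M N : isomorphic M N -> AA M -> AA N.
Proof.
by move=> [f [g fK gK]]; apply: (AA_quo (g := f)) => y; exists (g y).
Qed.

Lemma perp_torf B : torf AA (perp AA B).
Proof.
split; first split.
- by move=> M [].
- move=> M N MN [AM BM]; split; first exact: AA_iso AM.
  have [f /bij_inj fI] := isomorphic_sym MN.
  by move=> X BX h x; apply: (linear_inj0 fI); exact: (BM X BX (f \o h : {linear X -> M})).
- by move=> M M0; split; first exact: AA_zero.
- move=> X Y Z f g AY [fI gS ker_g] [AX BX] [AZ BZ]; split=> // M BM h m.
  have [|k kE] := linear_lift (h := h) fI.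
    by move=> x; apply/ker_g; exact: (BZ M BM (g \o h : {linear M -> Z})).
  by rewrite -kE (BX M BM k) linear0.
- move=> X Y f AX fI [AY BY]; split=> // M BM h m; apply: (linear_inj0 fI).
  exact: (BY M BM (f \o h : {linear M -> Y})).
Qed.

Lemma perp_anti B C : class_le B C -> class_le (perp AA C) (perp AA B).
Proof. by move=> BC X [AX CX]; split=> // M /BC /CX. Qed.

(** For [X] in [T], take a maximal submodule [W] among the images in [X] of objects of [T']. The
    quotient of [X] by [W] is right perpendicular to [T'], hence to [T], so the projection of [X]
    vanishes and [W] is all of [X]. *)
Lemma perp_reflect T T' : (forall M, AA M -> acc M) ->
  tors AA T -> tors AA T' -> class_le (perp AA T') (perp AA T) -> class_le T T'.
Proof.
move=> AA_acc [[T_AA _ _] _ _] [[T'_AA T'_iso T'_zero] T'_ext T'_quo] le X TX.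
have AX := T_AA _ TX.
pose C := [set W : set X | exists (S : lmodType A) (f : {linear S -> X}),
  T' S /\ range f = W].
have [||W [S [f [T'S fW]]] Wmax] := AA_acc _ AX C.
- have [Z Z0] := zero_module_ex A.
  have [f _] := @linear_ex _ Z X (fun=> 0) (fun a x y => esym (etrans (addr0 _) (scaler0 _ a))).
  by exists (range f), Z, f; split=> //; exact: T'_zero.
- by move=> _ [S [f [_ <-]]]; exact: submod_image (submod_setT S).
have Wm : submod W by rewrite -fW; exact: submod_image (submod_setT S).
have [Q [g [gS ker_g]]] := quotient_ex Wm.
have /le[_ /(_ X TX g) g0] : perp AA T' Q.
  split=> [|M T'M h]; first exact: AA_quo gS AX.
  have [I [p [i [pS iI pi]]]] := image_ex h.
  (* The preimage in [X] of the image of [h] is an extension of that image by [W], so it lies in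
     [T']; maximality of [W] then makes [h] zero. *)
  pose V := g @^-1` range i.
  have Vm : submod V by exact: submod_preim (submod_image _ (submod_setT I)).
  have [U [u [uI uV]]] := submodule_ex Vm.
  have [J [q [j [qS jI qj]]]] := image_ex f.
  have WJ x : W x <-> exists y, j y = x.
    rewrite -fW; split=> [[y _ <-]|[y <-]]; first by exists (q y).
    by have [z <-] := qS y; exists z.
  have [x|k kE] := linear_lift (h := j) uI.
    apply/uV; rewrite /V /preimage /=; have /ker_g -> : W (j x) by apply/WJ; exists x.
    by exists 0; rewrite ?linear0.
  have [x|r rE] := linear_lift (h := g \o u : {linear U -> Q}) iI.
    by have /uV[y _ yE] : exists z, u z = u x; [exists x|exists y].
  have AU : AA U := AA_sub uI AX.
  have T'U : T' U.
    apply: (T'_ext J U I k r) => //.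
    - split; first by move=> x y e; apply: jI; rewrite -!kE e.
      + move=> y; have [x xE] := gS (i y).
        have /uV[z zE] : V x by exists y.
        by exists z; apply: iI; rewrite rE /= zE.
      + move=> y; split=> [e|[x <-]]; last first.
          apply: (linear_inj0 iI); rewrite rE /= kE.
          by apply/ker_g/WJ; exists x.
        have /WJ[x xE] : W (u y) by apply/ker_g; rewrite -[g _]/((g \o u) y) -rE e linear0.
        by exists x; apply: uI; rewrite kE.
    - by apply: (T'_quo S J q) => //; exact: AA_sub jI AX.
    - by apply: (T'_quo M I p) => //; exact: AA_sub iI (AA_quo gS AX).
  have sVW : V `<=` W.
    apply: Wmax.
      by exists U, u; split=> //; apply/seteqP; split=> [x [y _ <-]|x /uV[y <-]];
        [apply/uV; exists y|exists y].
    move=> x /ker_g gx; rewrite /V /preimage /= gx; exists 0; rewrite ?linear0 //.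
  move=> m; rewrite -pi; have [x xE] := gS (i (p m)).
  by rewrite -xE; apply/ker_g/sVW; exists (p m).
apply: (T'_quo S X f) => // x.
by have [y _ <-] : range f x; [rewrite fW; apply/ker_g|exists y].
Qed.

(** [T] is the left perpendicular of [F]. For [X] in the right perpendicular of [T], take a minimal
    kernel [W] of an epimorphism from [X] onto an object of [F]; then [W] lies in [T], its inclusion
    is zero, and [X] is in [F]. *)
Lemma perp_surj F : (forall M, AA M -> dcc M) -> torf AA F ->
  exists T, tors AA T /\ perp AA T = F.
Proof.
move=> AA_dcc [[F_AA F_iso F_zero] F_ext F_sub].
pose T M := AA M /\ forall N, F N -> forall h : {linear M -> N}, forall x, h x = 0.
exists T; split.
  split; first split.
  - by move=> M [].
  - move=> M N MN [AM TM]; split; first exact: AA_iso AM.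
    move=> X FX h y; have [f [g fK gK]] := MN.
    by rewrite -(gK y); exact: (TM X FX (h \o f : {linear M -> X})).
  - by move=> M M0; split=> [|N _ h x]; [exact: AA_zero|rewrite (M0 x) linear0].
  - move=> X Y Z f g AY [fI gS ker_g] [AX TX] [AZ TZ]; split=> // N FN h y.
    have [|k kE] := linear_factor (h := h) gS.
      by move=> z /ker_g[x <-]; exact: (TX N FN (h \o f : {linear X -> N})).
    by rewrite -kE TZ.
  - move=> X Y g AY gS [AX TX]; split=> // N FN h y; have [x <-] := gS y.
    exact: (TX N FN (h \o g : {linear X -> N})).
apply: funext => X; apply: propext; split=> [[AX TX]|FX]; last first.
  by split=> [|M [_ TM] h m]; [exact: F_AA|exact: TM].
pose C := [set W : set X | exists (Q : lmodType A) (g : {linear X -> Q}),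
  [/\ forall y, exists x, g x = y, forall x, g x = 0 <-> W x & F Q]].
have Cm : C `<=` @submod A X.
  move=> W [Q [g [_ ker_g _]]].
  have -> : W = g @^-1` [set 0] by apply/seteqP; split=> x /ker_g.
  exact: submod_preim (submod_set0 Q).
have [|//|W [Q [g [gS ker_g FQ]]] Wmin] := AA_dcc _ AX C.
  have [Q [g [gS ker_g]]] := quotient_ex (submod_setT X).
  exists setT, Q, g; split=> //; apply: F_zero => y.
  by have [x <-] := gS y; exact/ker_g.
have [K [k [kI kW]]] := submodule_ex (Cm W (ex_intro _ Q (ex_intro _ g (And3 gS ker_g FQ)))).
have TK : T K.
  split=> [|N FN h x]; first exact: AA_sub kI AX.
  (* The quotient of [X] by the kernel of [h] is an extension of [Q] by the image of [h], so it lies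
     in [F]; minimality of [W] then forces [h] to vanish. *)
  have Vm : submod (k @` (h @^-1` [set 0])).
    by apply: submod_image; exact: submod_preim (submod_set0 N).
  have sVW : k @` (h @^-1` [set 0]) `<=` W by move=> _ [y _ <-]; apply/kW; exists y.
  have [Q' [g' [g'S ker_g']]] := quotient_ex Vm.
  have [I [p [i [pS iI pi]]]] := image_ex h.
  have [|j jE] := linear_factor (h := g' \o k : {linear K -> Q'}) pS.
    move=> y py; apply/ker_g'; exists y => //.
    by rewrite /preimage /= -pi py linear0.
  have [|r rE] := linear_factor (h := g) g'S.
    by move=> y /ker_g'/sVW/ker_g.
  have FQ' : F Q'.
    apply: (F_ext I Q' Q j r) => //; first exact: AA_quo g'S AX.
    - split.
      + apply: linear_inj => y; have [z <-] := pS y; rewrite jE.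
        move=> /ker_g'[z' /= hz' /kI e]; apply: (linear_inj0 iI).
        by rewrite pi -e.
      + by move=> y; have [z <-] := gS y; exists (g' z).
      + move=> y; have [z <-] := g'S y; rewrite rE ker_g kW.
        split=> [[w <-]|[w]]; first by exists (p w); rewrite jE.
        have [v <-] := pS w; rewrite jE => e; apply/kW.
        have : g' (k v - z) = 0 by rewrite linearB [g' (k v)]e subrr.
        move=> /ker_g'/sVW Wvz; rewrite -[z](subKr (k v)).
        have Wkv : W (k v) by apply/kW; exists v.
        by apply: (submodB (W := W)) => //; apply: Cm; exists Q, g.
    - by apply: (F_sub I N i) => //; exact: AA_sub iI (F_AA _ FN).
  have Cker : C (k @` (h @^-1` [set 0])) by exists Q', g'.
  have Wkx : W (k x) by apply/kW; exists x.
  by have [y hy /kI <-] := Wmin _ Cker sVW _ Wkx.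
have [AK _] := TK.
have gI : injective g.
  apply: linear_inj => x /ker_g/kW[y <-]; exact: TX.
by apply: F_iso FQ; apply: isomorphic_sym; exact: isomorphicP gI gS.
Qed.

End TorsionPairs.

(** * Localized modules as modules over [L] with invertible denominators *)

Section Localization.
Variables (R : comPzRingType) (L : algebra R).
Implicit Types (M N X K I : lmodType L) (r : R).

Local Notation "r ** x" := (alg_map L r *: x) (at level 40, left associativity).

Definition ract M r (x : M) : M := r ** x.

Lemma ract_linear M r : linear (ract r : M -> M).
Proof. by move=> a x y; rewrite /ract scalerDr scale_mapC. Qed.

HB.instance Definition _ M r :=
  GRing.isLinear.Build L M M *:%R (ract r) (ract_linear r).

Section Prime.
Variable p : spec R.
Implicit Types (s t u : den p) (C F : lmodType L -> Prop) (Y Z : lmodType (loc_ring L p)).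

Definition loc_map (a : L) : loc_ring L p := frac (a : L^o) den1.

Lemma loc_map_zmod : zmod_morphism loc_map.
Proof.
move=> a b; apply/eqP; rewrite eq_sym subr_eq; apply/eqP.
by rewrite -[RHS]frac_addl subrK.
Qed.

Lemma loc_map_monoid : monoid_morphism loc_map.
Proof.
split=> // a b; rewrite -[RHS]/(loc_scale _ _) loc_scaleE.
apply/frac_eqP; exists den1 => /=; by rewrite !mulr1.
Qed.

HB.instance Definition _ :=
  GRing.isZmodMorphism.Build L (loc_ring L p) loc_map loc_map_zmod.
HB.instance Definition _ :=
  GRing.isMonoidMorphism.Build L (loc_ring L p) loc_map loc_map_monoid.

Local Notation "Y |_L" := (restr loc_map Y) (at level 2, format "Y |_L").

Definition invden s : loc_ring L p := frac (1 : L^o) s.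

(** Reduces linearity over the localized algebra to linearity over [L] and compatibility with
    division. *)
Lemma loc_scalarE (a : loc_ring L p) : exists b s, a = invden s * loc_map b.
Proof.
have [b [s ->]] := fracP a; exists b, s.
rewrite -[RHS]/(loc_scale _ _) loc_scaleE scale1r.
by apply/frac_eqP; exists den1 => /=; rewrite !mulr1.
Qed.

Lemma frac_invden X (x : X) s : frac x s = invden s *: (frac x den1 : loc p X).
Proof.
rewrite -[RHS]/(loc_scale _ _) loc_scaleE scale1r.
by apply/frac_eqP; exists den1 => /=; rewrite !mulr1.
Qed.

Lemma loc_map_frac X (x : X) a : frac (a *: x) den1 = loc_map a *: (frac x den1 : loc p X).
Proof.
rewrite -[RHS]/(loc_scale _ _) loc_scaleE.
by apply/frac_eqP; exists den1 => /=; rewrite !mulr1.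
Qed.

Lemma invdenM s : invden s * loc_map (alg_map L (sval s)) = 1.
Proof.
rewrite -[LHS]/(loc_scale _ _) loc_scaleE.
apply/frac_eqP; exists den1 => /=; rewrite !mul1r !mulr1 !scale1r.
by rewrite /GRing.scale /= mulr1 rmorph1 mul1r.
Qed.

Lemma invden_comm s (a : L) : invden s * loc_map a = loc_map a * invden s.
Proof.
rewrite -[LHS]/(loc_scale _ _) -[RHS]/(loc_scale _ _) !loc_scaleE.
by apply/frac_eqP; exists den1 => /=; rewrite !mul1r !mulr1 /GRing.scale /= mul1r mulr1.
Qed.

Section Module.
Variable Y : lmodType (loc_ring L p).

Definition divden s (y : Y|_L) : Y|_L := invden s *: (y : Y).

Lemma divdenK s (y : Y|_L) : divden s (sval s ** y) = y.
Proof. by rewrite /divden scalerA invdenM scale1r. Qed.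

Lemma divden_linear s : linear (divden s).
Proof.
move=> a x y; rewrite /divden scalerDr; congr (_ + _).
by rewrite scalerA invden_comm -scalerA.
Qed.

HB.instance Definition _ s :=
  GRing.isLinear.Build L Y|_L Y|_L *:%R (divden s) (divden_linear s).

Lemma divdenKV s (y : Y|_L) : sval s ** divden s y = y.
Proof. by rewrite -linearZ; exact: divdenK. Qed.

Lemma den_inj s (y : Y|_L) : sval s ** y = 0 -> y = 0.
Proof. by move=> e; rewrite -[y](divdenK s) e linear0. Qed.

Lemma den_actI s : injective (fun y : Y|_L => sval s ** y).
Proof. by move=> y z /(congr1 (divden s)); rewrite !divdenK. Qed.

Lemma divden_eq s (y z : Y|_L) : y = sval s ** z -> divden s y = z.
Proof. by move=> ->; exact: divdenK. Qed.

Lemma divden_mulr s t (y : Y|_L) : divden (den_mul s t) (sval t ** y) = divden s y.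
Proof. by apply: divden_eq; rewrite /= mulrC -actA divdenKV. Qed.

Lemma divden_mull s t (y : Y|_L) : divden (den_mul s t) (sval s ** y) = divden t y.
Proof. by apply: divden_eq; rewrite /= -actA divdenKV. Qed.

Lemma submod_locP (W : set Y) :
  submod W <-> submod (W : set Y|_L) /\ forall s y, W (sval s ** (y : Y|_L)) -> W y.
Proof.
split=> [Wm|[Wm Ws]].
  split; first by split; [exact: Wm.1|move=> a x y; exact: Wm.2].
  by move=> s y /(submodZ (invden s) Wm); rewrite -[_ *: _]/(divden s _) divdenK.
split=> [|a x y Wx Wy]; first exact: Wm.1.
have [b [s ->]] := loc_scalarE a; rewrite -scalerA.
apply: (submodD (W := W : set Y|_L)) => //; apply: (Ws s).
by rewrite -[_ *: (_ *: x)]/(divden s _) divdenKV; exact: (submodZ b Wm Wx).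
Qed.

End Module.

Lemma loc_linear_ex Y Z (h : {linear Y|_L -> Z|_L}) :
  exists k : {linear Y -> Z}, forall y, k y = h y.
Proof.
have hd s (y : Y|_L) : h (divden s y) = divden s (h y).
  by rewrite -[LHS](divdenK s) -linearZ /= divdenKV.
apply: linear_ex => a x y; have [b [s ->]] := loc_scalarE a.
transitivity (divden s (b *: h x) + h y).
  rewrite -linearZ /= -hd -raddfD; congr (h (_ + y)).
  by rewrite -scalerA.
by rewrite -scalerA.
Qed.

(** The universal property of localization. The value is computed on the chosen representative;
    since denominators act injectively on [Y], every representative gives the same value. *)
Lemma loc_map_ex X Y (h : {linear X -> Y|_L}) :
  exists k : {linear loc p X -> Y}, forall x s, k (frac x s) = divden s (h x).
Proof.
pose k (z : loc p X) : Y := divden (denom z) (h (num z)).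
have kE x s : k (frac x s) = divden s (h x).
  rewrite /k; have /frac_eqP[u e] := fracK (frac x s).
  move: (num _) (denom _) e => x' s' e.
  apply/divden_eq/(@den_actI _ (den_mul u s)) => /=.
  by rewrite -linearZ /= e linearZ /= actA mulrAC -[in RHS]actA divdenKV.
have [|k' k'E] := @linear_ex _ (loc p X)|_L Y|_L k.
  move=> b z w; have [x [s ->]] := fracP z; have [y [t ->]] := fracP w.
  have -> : b *: (frac x s : (loc p X)|_L) = frac (b *: x) s.
    rewrite -[LHS]/(loc_scale _ _) loc_scaleE.
    by apply/frac_eqP; exists den1 => /=; rewrite !mul1r.
  rewrite [_ + _]frac_add !kE.
  have -> : h (sval t ** (b *: x) + sval s ** y) =
      sval t ** (b *: h x) + sval s ** h y by rewrite linearD !linearZ.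
  rewrite linearD /=.
  by rewrite divden_mulr divden_mull linearZ.
have [k'' k''E] := loc_linear_ex k'.
by exists k'' => x s; rewrite k''E k'E.
Qed.

Definition frac_map X (x : X) : (loc p X)|_L := frac x den1.

Lemma frac_map_linear X : linear (@frac_map X).
Proof. by move=> a x y; rewrite /frac_map frac_addl loc_map_frac. Qed.

HB.instance Definition _ X :=
  GRing.isLinear.Build L X (loc p X)|_L *:%R (@frac_map X) (@frac_map_linear X).

Lemma frac_divden X (x : X) s : frac x s = divden s (frac_map x).
Proof. exact: frac_invden. Qed.

Definition generating X Y (f : {linear X -> Y|_L}) : Prop :=
  forall y : Y|_L, exists s x, f x = sval s ** y.

(** By [loc_isoP], this says that [f] exhibits [Y] as the localization of [X]. *)
Definition locmap X Y (f : {linear X -> Y|_L}) : Prop :=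
  generating f /\ forall x, f x = 0 -> exists s : den p, sval s ** x = 0.

Lemma frac_eq0 X (x : X) : frac_map x = 0 <-> exists s : den p, sval s ** x = 0.
Proof.
rewrite -[0]/(frac 0 den1) frac_eqP; split=> -[u].
  by rewrite scaler0 mulr1 => ?; exists u.
by move=> e; exists u; rewrite mulr1 scaler0.
Qed.

Lemma frac_locmap X : locmap (@frac_map X : {linear X -> (loc p X)|_L}).
Proof.
split=> [z|x /frac_eq0 //]; have [x [s ->]] := fracP z.
by exists s, x; rewrite frac_divden divdenKV.
Qed.

Lemma loc_isoP X Y : isomorphic (loc p X : lmodType _) Y <->
  exists f : {linear X -> Y|_L}, locmap f.
Proof.
split=> [[f fB]|[f [fG f0]]].
  have [h hE] := linear_restr loc_map f.
  have [g fK gK] := fB.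
  exists (h \o @frac_map X); split.
    move=> y; have [s [x e]] := (frac_locmap X).1 (g y).
    by exists s, x; rewrite /= e linearZ /= hE gK.
  move=> x; rewrite /= hE => /(linear_inj0 (bij_inj fB)); exact: (frac_eq0 x).1.
have [k kE] := loc_map_ex f; apply: (isomorphicP (f := k)).
  apply: linear_inj => z; have [x [s ->]] := fracP z.
  rewrite kE => e; have /f0 xt : f x = 0 by rewrite -[f x](divdenKV s) e scaler0.
  by rewrite frac_divden (frac_eq0 x).2 // linear0.
by move=> y; have [s [x e]] := fG y; exists (frac x s); rewrite kE e divdenK.
Qed.

Lemma den_uniform X (V : set X) (s : seq X) : submod V ->
  (forall g, g \in s -> exists u : den p, V (sval u ** g)) ->
  exists u : den p, forall x, lspan s x -> V (sval u ** x).
Proof.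
move=> Vm; elim: s => [|g s IH] h.
  by exists den1 => x /lspan_nil ->; rewrite scaler0; exact: Vm.1.
have [|u uE] := IH; first by move=> k ks; apply: h; rewrite inE ks orbT.
have [v vE] := h g (mem_head _ _).
exists (den_mul u v) => x; apply: (lspan_min (W := ract (sval (den_mul u v)) @^-1` V)).
  exact: submod_preim.
move=> k; rewrite inE /preimage /= /ract /= => /predU1P[->|/mem_lspan /uE ks].
  by rewrite -actA; exact: submodZ.
by rewrite mulrC -actA; exact: submodZ.
Qed.

(** [K] is the [L]-span of finitely many generators of [Y]. The elements with a multiple in this
    span form a submodule over the localized algebra, hence exhaust [Y]. *)
Lemma lattice_ex Y : fingen Y ->
  exists (K : lmodType L) (k : {linear K -> Y|_L}),
    [/\ fingen K, injective k & generating k].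
Proof.
move=> /fingenP[s sE].
have [K [k [kI kE]]] := submodule_ex (submod_lspan (s : seq Y|_L)).
exists K, k; split=> //.
  apply: (fingen_range (s := (s : seq Y|_L)) kI); apply/seteqP.
  by split=> [y [x _ <-]|y /kE[x <-]]; [apply/kE; exists x|exists x].
pose W : set Y := [set y : Y|_L | exists u : den p, lspan (s : seq Y|_L) (sval u ** y)].
have Wm : submod W.
  apply/submod_locP; split; last first.
    by move=> v y [u]; rewrite actA => Wuv; exists (den_mul u v).
  split; first by exists den1; rewrite scaler0; exact: (submod_lspan _).1.
  move=> a x y [u Wx] [v Wy]; exists (den_mul u v).
  rewrite scalerDr -scale_mapC /= -[in X in _ + X]actA mulrC -actA.
  apply: (submod_lspan _).2; first exact: submodZ (submod_lspan _) Wx.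
  exact: submodZ (submod_lspan _) Wy.
move=> y; have [u /kE[x xE]] : W y; last by exists u, x.
have : lspan s y by rewrite sE.
apply: (lspan_min Wm) => g gs; exists den1; rewrite /= rmorph1 scale1r.
exact: mem_lspan.
Qed.

Lemma locmap_class C X Y (f : {linear X -> Y|_L}) :
  C X -> locmap f -> loc_class C Y.
Proof. by move=> CX fl; exists X; split=> //; apply/loc_isoP; exists f. Qed.

Lemma loc_classP C Y : loc_class C Y <->
  exists X (f : {linear X -> Y|_L}), C X /\ locmap f.
Proof.
split=> [[X [CX /loc_isoP[f fl]]]|[X [f [CX fl]]]]; first by exists X, f.
exact: locmap_class CX fl.
Qed.

Lemma inj_locmap X Y (f : {linear X -> Y|_L}) :
  injective f -> generating f -> locmap f.
Proof.
by move=> fI fG; split=> // x /(linear_inj0 fI) ->; exists den1; rewrite scaler0.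
Qed.

(** The image of [f] is a factor of [X], so it lies in [C], and its inclusion into [Y] is a
    localization map. *)
Lemma generating_class C X Y (f : {linear X -> Y|_L}) :
  closed_under_factors (@fingen L) C -> fingen X -> C X -> generating f ->
  loc_class C Y.
Proof.
move=> Cq gX CX fG; have [I [q [i [qS iI qi]]]] := image_ex f.
apply: (@locmap_class _ I _ i); first by apply: (Cq X I q) => //; exact: fingen_quo qS gX.
apply: inj_locmap => // y; have [s [x e]] := fG y.
by exists s, (q x); rewrite qi.
Qed.

Lemma tors_class_generating C Y : loc_class C Y ->
  exists X (f : {linear X -> Y|_L}), C X /\ generating f.
Proof. by move=> /loc_classP[X [f [CX [fG _]]]]; exists X, f. Qed.

(** The elements killed by some denominator form a finitely generated submodule, so one denominator
    kills them all. *)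
Lemma torsion_bounded X : acc X ->
  exists u : den p, forall (x : X) (s : den p), sval s ** x = 0 -> sval u ** x = 0.
Proof.
move=> accX; pose W := [set x : X | exists s : den p, sval s ** x = 0].
have Wm : submod W.
  split; first by exists den1; rewrite scaler0.
  move=> a x y [s sx] [t ty]; exists (den_mul s t).
  by rewrite scalerDr -scale_mapC /= -[in X in _ + X]actA mulrC -actA sx ty !scaler0 addr0.
have [w wE] := acc_noeth accX Wm.
have [|u uE] := @den_uniform X [set 0] w (submod_set0 X).
  by move=> g /mem_lspan; rewrite -wE.
by exists u => x s sx; apply: uE; rewrite -wE; exists s.
Qed.

(** A multiple of [k] by a denominator [u] lands in the image of [f]. Multiplication by a
    denominator [t] that kills the kernel of [f] maps this image injectively into [X], and the
    composite embeds [K] into [X]. *)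
Lemma torf_class_sub F X Y (f : {linear X -> Y|_L}) K (k : {linear K -> Y|_L}) :
  closed_under_subobjects (@fingen L) F -> acc X -> F X -> locmap f ->
  fingen K -> injective k -> F K.
Proof.
move=> F_sub accX FX [fG f0] fgK kI.
have [I [q [i [qS iI qi]]]] := image_ex f.
have [t tE] := torsion_bounded accX.
have /fingenP[w wE] := fgK.
have [||u uE] := @den_uniform K (k @^-1` range f) w.
- exact: submod_preim (submod_image f (submod_setT X)).
- move=> g _; have [s [x e]] := fG (k g).
  by exists s; exists x; rewrite // e linearZ.
have [|h hE] := linear_factor (h := ract (sval t) : {linear X -> X}) qS.
  move=> x qx; have [|s] := f0 x; first by rewrite -qi qx linear0.
  exact: tE.
have [|l lE] := linear_lift (h := k \o ract (sval u) : {linear K -> Y|_L}) iI.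
  move=> x; have [|z _ zE] := uE x; first by rewrite wE.
  by exists (q z); rewrite qi zE.
apply: (F_sub K X (h \o l : {linear K -> X})) => //.
apply: linear_inj => x; have [z zE] := qS (l x); rewrite /= -zE hE => tz.
have /(den_inj (s := t)) fz : sval t ** f z = 0 by rewrite -linearZ [_ *: _]tz linear0.
apply: (linear_inj0 kI); apply: (@den_inj _ u).
by rewrite -linearZ -[k _]lE -zE qi.
Qed.

Lemma torf_classP F Y : (forall M, fingen M -> acc M) -> torf (@fingen L) F ->
  fingen Y -> loc_class F Y <->
    forall K (k : {linear K -> Y|_L}), fingen K -> injective k -> F K.
Proof.
move=> Lacc [[F_fg _ _] _ F_sub] fgY; split=> [/loc_classP[X [f [FX fl]]] K k fgK kI|h].
  exact: torf_class_sub F_sub (Lacc _ (F_fg _ FX)) FX fl fgK kI.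
have [K [k [fgK kI kG]]] := lattice_ex fgY.
exact: locmap_class (h K k fgK kI) (inj_locmap kI kG).
Qed.

End Prime.
End Localization.

(** * Finiteness over [R], and modules killed by powers of a prime *)

Section NoetherianAlgebra.
Variables (R : comPzRingType) (L : algebra R).
Implicit Types (M N X K : lmodType L) (r : R) (p q : spec R).

Local Notation "r ** x" := (alg_map L r *: x) (at level 40, left associativity).

Lemma noetherian_noeth : noetherian_ring R -> noeth R^o.
Proof.
move=> hR W Wm; pose I : {pred R^o} := fun x => `[<W x>].
have WI : [set` I] = W by apply/seteqP; split=> x /= => [/asboolP|Wx]; last exact/asboolP.
have [|n [g gE]] := hR I; first by apply/submod_pred; rewrite WI.
exists [seq (g i : R^o) | i <- enum 'I_n]; apply/seteqP; split=> [x Wx|].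
  have /gE[c ->] : x \in I by apply/asboolP.
  apply: (submod_sum (W := lspan _)); first exact: submod_lspan.
  move=> i; apply: (submodZ (W := lspan _)); first exact: submod_lspan.
  by apply: mem_lspan; apply: map_f; rewrite mem_enum.
apply: lspan_min => // _ /mapP[i _ ->]; rewrite -WI /=; apply/gE.
exists (fun j => if j == i then 1 else 0).
by rewrite (bigD1 i) //= eqxx mul1r big1 ?addr0 // => j /negPf->; rewrite mul0r.
Qed.

Hypothesis hRL : noetherian_algebra L.

Lemma fingen_restr M : fingen M -> fingen (restr (alg_map L) M).
Proof.
have [n [g gE]] := hRL.2; move=> [m [h hE]].
apply/fingenP; exists [seq (g i *: h j : restr (alg_map L) M) | i <- enum 'I_n, j <- enum 'I_m].
apply/seteqP; split=> // x _; have [c ->] := hE x.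
apply: (submod_sum (W := lspan _)) => [|j]; first exact: submod_lspan.
have [d ->] := gE (c j); rewrite scaler_suml.
apply: (submod_sum (W := lspan _)) => [|i]; first exact: submod_lspan.
rewrite -scalerA; apply: (submodZ (W := lspan _)); first exact: submod_lspan.
by apply: mem_lspan; apply: allpairs_f; rewrite mem_enum.
Qed.

Lemma restr_acc M : fingen M -> acc (restr (alg_map L) M).
Proof.
move=> /fingen_restr; move=> /(fingen_noeth (noetherian_noeth hRL.1)).
exact: noeth_acc.
Qed.

Lemma alg_acc M : fingen M -> acc M.
Proof.
move=> /restr_acc; apply: (@has_max_inv _ _ _ _ id) => // W Wm.
by split; [exact: Wm.1|move=> r x y; exact: Wm.2].
Qed.

Lemma linear_act M N (f : {linear M -> N}) r x : f (r ** x) = r ** f x.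
Proof. exact: linearZ. Qed.

Section Powers.
Variable p : spec R.

(* [pkill n x] means p^n x = 0. *)
Fixpoint pkill M n (x : M) : Prop :=
  if n is m.+1 then forall r, r \in p -> pkill m (r ** x) else x = 0.

Lemma submod_pkill M n : submod [set x : M | pkill n x].
Proof.
elim: n => [|n [IH0 IHl]]; first exact: submod_set0.
split=> [r _|a x y px py r rp]; first by rewrite scaler0.
by rewrite scalerDr -scale_mapC; apply: IHl; [exact: px|exact: py].
Qed.

Lemma pkill_leq M m n (x : M) : (m <= n)%N -> pkill m x -> pkill n x.
Proof.
elim: m n x => [n x _ ->|m IH [//|n] x mn px r rp]; first exact: (submod_pkill M n).1.
by apply: IH => //; exact: px.
Qed.

Lemma pkill_linear M N (f : {linear M -> N}) n x : pkill n x -> pkill n (f x).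
Proof.
elim: n x => [x /= ->|n IH x px r rp]; first by rewrite linear0.
by rewrite -linearZ; apply: IH; exact: px.
Qed.

Lemma pkill_inj M N (f : {linear M -> N}) n x :
  injective f -> pkill n (f x) -> pkill n x.
Proof.
move=> fI; elim: n x => [x /(linear_inj0 fI) //|n IH x px r rp].
by apply: IH; rewrite linearZ; exact: px.
Qed.

Lemma pkill_factor M N (g : {linear M -> N}) n m :
  (forall x, g x = 0 -> pkill m x) -> forall x, pkill n (g x) -> pkill (n + m) x.
Proof.
move=> gm; elim: n => [x /gm //|n IH x px r rp].
by apply: IH; rewrite linearZ; exact: px.
Qed.

Lemma pkill_exp M n (x : M) r : r \in p -> pkill n x -> r ^+ n ** x = 0.
Proof.
move=> rp; elim: n x => [x /= ->|n IH x px]; first by rewrite scaler0.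
by rewrite exprSr -actA; apply: IH; exact: px.
Qed.

End Powers.

Section Saturated.
Variables (p : spec R) (Y : lmodType (loc_ring L p)).
Local Notation Y' := (restr (loc_map p) Y).
Implicit Types (S W : set Y') (s t u : den p).

(* Identified with the submodules of Y over R_p. *)
Record saturated S : Prop := Saturated {
  sat0 : S 0;
  satD : forall x y, S x -> S y -> S (x + y);
  satZ : forall r x, S x -> S (r ** x);
  satV : forall s x, S (sval s ** x) -> S x }.

Lemma satN S x : saturated S -> S x -> S (- x).
Proof. by move=> h /(satZ h (-1)); rewrite rmorphN rmorph1 scaleN1r. Qed.

Lemma satB S x y : saturated S -> S x -> S y -> S (x - y).
Proof. by move=> h Sx Sy; apply: satD => //; apply: satN. Qed.

Lemma submod_saturated (W : set Y) : submod W -> saturated W.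
Proof.
move=> /submod_locP[Wm Ws]; split; [exact: Wm.1| |move=> r x; exact: submodZ|exact: Ws].
by move=> x y; exact: submodD.
Qed.

Lemma saturated_set0 : saturated [set 0].
Proof.
split=> [//|x y -> ->|r x ->|s x /= /den_inj //]; first by rewrite addr0.
by rewrite scaler0.
Qed.

Lemma saturatedI S W : saturated S -> saturated W -> saturated (S `&` W).
Proof.
move=> hS hW; split; first by split; exact: sat0.
- by move=> x y [Sx Wx] [Sy Wy]; split; exact: satD.
- by move=> r x [Sx Wx]; split; exact: satZ.
- by move=> s x [Sx Wx]; split; [exact: satV Sx|exact: satV Wx].
Qed.

(** For saturated [S], this is the submodule over the local ring generated by [S] and [g], with
    fractions cleared. *)
Definition adjoin S (g : Y') : set Y' :=
  [set y | exists s r, S (sval s ** y - r ** g)].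

Lemma saturated_adjoin S g : saturated S -> saturated (adjoin S g).
Proof.
move=> hS; split.
- by exists den1, 0; rewrite scaler0 rmorph0 scale0r subr0; exact: sat0.
- move=> x y [s [a Sx]] [t [b Sy]]; exists (den_mul s t), (sval t * a + sval s * b).
  have := satD hS (satZ hS (sval t) Sx) (satZ hS (sval s) Sy).
  rewrite !scalerBr !actA rmorphD scalerDl scalerDr opprD addrACA.
  by rewrite (mulrC (sval t) (sval s)).
- move=> r x [s [a Sx]]; exists s, (r * a); have := satZ hS r Sx.
  by rewrite scalerBr !actA mulrC.
- by move=> s x [t [a]]; rewrite actA => Sx; exists (den_mul t s), a.
Qed.

Lemma sub_adjoin S g : S `<=` adjoin S g.
Proof.
by move=> y Sy; exists den1, 0; rewrite !(rmorph1, rmorph0) scale1r scale0r subr0.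
Qed.

Lemma mem_adjoin S g : saturated S -> adjoin S g g.
Proof.
by move=> hS; exists den1, 1; rewrite subrr; exact: sat0.
Qed.

(* The quotient of [adjoin S g] by [S] is a vector space of dimension at most
   one over the residue field at p. *)
Lemma adjoin_step S g W : saturated S -> (forall r, r \in p -> S (r ** g)) ->
  saturated W -> W `<=` adjoin S g ->
  W `<=` S \/ forall x, adjoin S g x -> exists2 w, W w & S (x - w).
Proof.
move=> hS pg hW sW; have [|nW] := pselect (W `<=` S); first by left.
right=> x [t [a Sx]].
have [w Ww nSw] : exists2 w, W w & ~ S w.
  apply: contrapT => h; apply: nW => w Ww; apply: contrapT => nSw.
  by apply: h; exists w.
have [s [r Sw]] := sW _ Ww.
have rp : r \notin p.
  apply/negP => /pg Srg; apply: nSw; apply: (satV hS (s := s)).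
  by rewrite -[_ ** w](subrK (r ** g)); exact: satD.
pose u : den p := exist _ r rp.
(* Modulo [S], [t] times [x] is [a] times [g], and [s] times [w] is [r] times [g]; solving for [x]
   gives this multiple of [w]. *)
exists (divden (den_mul u t) ((a * sval s) ** w)).
  by apply: (satV hW (s := den_mul u t)); rewrite divdenKV; exact: satZ.
apply: (satV hS (s := den_mul u t)); rewrite scalerBr divdenKV /= -!actA.
have -> : r ** (sval t ** x) - a ** (sval s ** w) =
    r ** (sval t ** x - a ** g) - a ** (sval s ** w - r ** g).
  rewrite !scalerBr !actA (mulrC a r) opprB addrA.
  by rewrite subrK.
by apply: satB => //; exact: satZ.
Qed.

(** The generators are adjoined one at a time, each giving a step for [has_min_step] by
    [adjoin_step]. *)
Lemma saturated_generators S (gs : seq Y') :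
  saturated S -> has_min (saturated `&` below S) ->
  (forall g, g \in gs -> forall r, r \in p -> S (r ** g)) ->
  exists S', [/\ saturated S', S `<=` S', forall g, g \in gs -> S' g
    & has_min (saturated `&` below S')].
Proof.
move=> hS hm; elim: gs => [|g gs IH] hg; first by exists S; split=> // g; rewrite in_nil.
have [|S' [hS' sS Sg hm']] := IH; first by move=> h hgs; apply: hg; rewrite inE hgs orbT.
exists (adjoin S' g); split; first exact: saturated_adjoin.
- by move=> y /sS; exact: sub_adjoin.
- move=> h; rewrite inE => /predU1P[->|/Sg Sh]; first exact: mem_adjoin.
  exact: sub_adjoin.
- apply: has_min_step hm'.
  + by move=> W hW x y; exact: satD.
  + by move=> W hW x y; exact: satB.
  + by move=> W hW; exact: saturatedI.
  + move=> W hW sW; apply: adjoin_step => // r rp.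
    by apply: sS; apply: hg => //; exact: mem_head.
Qed.

(** A saturated set is determined by its preimage in [K], a Noetherian module over [R]. *)
Lemma saturated_max K (k : {linear K -> Y'}) :
  fingen K -> generating k -> has_max saturated.
Proof.
move=> /restr_acc accK kG; apply: (has_max_inv (h := preimage k)) accK.
- move=> W hW; split; first by rewrite /preimage /= linear0; exact: sat0.
  move=> r x y Wx Wy; rewrite /preimage /= linearD; apply: satD => //.
  have -> : k (r *: x) = r ** k x by exact: linear_act.
  exact: satZ.
- by move=> V W; exact: preimage_subset.
- move=> V W hV hW h y Vy; have [s [x e]] := kG y.
  by apply: (satV hW (s := s)); rewrite -e; apply: h; rewrite /preimage /= e; exact: satZ.
Qed.

(** Submodules of [Y] are saturated, so chains of saturated sets suffice. For the descending
    condition, [K] is filtered by the elements killed by powers of [p]: each layer is generated over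
    [R] by finitely many elements, which [p] sends into the previous one. *)
Lemma generating_finite_length K (k : {linear K -> Y'}) n :
  fingen K -> generating k -> (forall x : K, pkill p n x) -> finite_length Y.
Proof.
move=> fgK kG Kn; have accK := restr_acc fgK.
have [accY minY] : acc Y /\ has_min saturated; last first.
  apply: chain_finite_length => //; apply: (has_min_inv (h := id)) minY => //.
  exact: submod_saturated.
split.
  apply: (has_max_inv (h := id)) (saturated_max fgK kG) => //.
  exact: submod_saturated.
suff h m : exists S, [/\ saturated S, forall x, pkill p m x -> S (k x)
    & has_min (saturated `&` below S)].
  have [S [hS kS hm]] := h n => C C0 CP; apply: hm => // W CW.
  split; first exact: CP.
  move=> y _; have [s [x e]] := kG y; apply: (satV hS (s := s)); rewrite -e.
  exact: kS.
elim: m => [|m [S [hS kS hm]]].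
  exists [set 0]; split=> [|x /= ->|]; [exact: saturated_set0|exact: linear0|].
  move=> C [W CW] CP; exists W => // W' CW' _ x /((CP _ CW).2) ->.
  exact: sat0 (CP _ CW').1.
have Wm : submod ([set x : K | pkill p m.+1 x] : set (restr (alg_map L) K)).
  have [h0 hl] := submod_pkill p K m.+1.
  by split=> // r x y; exact: hl.
have [gs gsE] := acc_noeth accK Wm.
have [|S' [hS' sS Sg hm']] := @saturated_generators S (map k gs) hS hm.
  move=> _ /mapP[g ggs ->] r rp.
  have : [set x : K | pkill p m.+1 x] g by rewrite gsE; exact: mem_lspan.
  by move=> /(_ r rp)/kS; rewrite linear_act.
exists S'; split=> // x px; have : lspan gs x by rewrite -gsE.
apply: (lspan_min (W := k @^-1` S' : set (restr (alg_map L) K))).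
  split; first by rewrite /preimage /= linear0; exact: sat0.
  move=> r y z Wy Wz; rewrite /preimage /= linearD; apply: satD => //.
  have -> : k (r *: y) = r ** k y by exact: linear_act.
  exact: satZ.
by move=> g ggs; apply: Sg; exact: map_f.
Qed.

(** A form of Nakayama's lemma. The multiple of [S'] by [r] lies in [S] or fills [S'] modulo [S];
    the second case is refuted with a saturated set maximal among those containing [S] but not
    [S']. *)
Lemma maximal_in_pkill K (k : {linear K -> Y'}) (S S' : {pred Y}) r :
  fingen K -> generating k -> submod_closed S -> submod_closed S' ->
  maximal_in S S' -> r \in p -> forall x : Y', x \in S' -> r ** x \in S.
Proof.
move=> fgK kG Sm S'm SS' rp.
have hS : saturated [set` S] by exact/submod_saturated/submod_pred.
have hS' : saturated [set` S'] by exact/submod_saturated/submod_pred.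
have [f fE] := loc_linear_ex (ract r : {linear Y' -> Y'}).
have [|sW|h] := maximal_in_step Sm S'm SS' (submod_image f ((submod_pred S').1 S'm)).
  by move=> _ [x Sx <-]; rewrite fE; exact: satZ.
- by move=> x Sx; apply: sW; exists x; rewrite ?fE.
exfalso; have [sSS' nSS' _] := SS'.
pose C : set (set Y') := [set W | [/\ saturated W, [set` S] `<=` W & ~ [set` S'] `<=` W]].
have [||W [hW SW nW] Wmax] := saturated_max fgK kG (C := C).
- by exists [set` S]; split=> //; exact: nSS'.
- by move=> W [].
apply: nW => x Sx; have [_ [y Sy <-] Sxy] := h x Sx.
rewrite -[x](subrK (f y)); apply: (satD hW) (SW _ Sxy) _.
rewrite fE /= /ract; apply: contrapT => nWry.
pose g := r ** (y : Y'); have hA := saturated_adjoin g hW.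
have : adjoin W g y.
  have [|nA] := pselect ([set` S'] `<=` adjoin W g); first exact.
  exfalso; apply: nWry; apply: (Wmax (adjoin W g)).
  - by split=> // z /SW; exact: sub_adjoin.
  - exact: sub_adjoin.
  - exact: mem_adjoin.
(* Now [s] and [c * r] act equally on [y] modulo [W]. Their difference is outside [p] since [r] is
   in [p], so [W] contains [y], hence also [r ** y]. *)
move=> [s [c Wsc]]; have u_notin : sval s - c * r \notin p.
  apply/negP => scr; move: (svalP s); rewrite -[sval s](subrK (c * r)).
  have /submod_pred pm := spec_ideal p.
  by rewrite (submodD pm scr (submodZ c pm rp)).
pose u : den p := exist _ (sval s - c * r) u_notin.
apply: nWry; apply: (satZ hW); apply: (satV hW (s := u)).
by rewrite /= rmorphB scalerBl -[in X in _ - X]actA.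
Qed.

Lemma finite_length_pkill : finite_length Y ->
  exists n, forall y : Y', pkill p n y.
Proof.
move=> flY; have [K [k [fgK _ kG]]] := lattice_ex (finite_length_fingen flY).
have [n [S [Sm S0 Sn Smax]]] := flY; exists n => y.
suff h i : (i <= n)%N -> forall x : Y', x \in S i -> pkill p i x.
  by apply: h => //; rewrite Sn.
elim: i => [_ x|i IH lt_in x Sx r rp]; first by rewrite S0 inE => /eqP.
apply: IH; first exact: ltnW.
exact: (maximal_in_pkill fgK kG (Sm i) (Sm i.+1) (Smax i lt_in)).
Qed.

End Saturated.
End NoetherianAlgebra.

(** * Coprimary modules *)

Section Coprimary.
Variables (R : comPzRingType) (L : algebra R).
Hypothesis hRL : noetherian_algebra L.
Implicit Types (M N X K Q I J : lmodType L) (r : R) (p q : spec R).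

Local Notation "r ** x" := (alg_map L r *: x) (at level 40, left associativity).

(** For nonzero finitely generated [K] over a Noetherian algebra this says that [p] is its only
    associated prime. *)
Definition coprimary p K : Prop :=
  (exists n, forall x : K, pkill p n x) /\
  forall (s : den p) (x : K), sval s ** x = 0 -> x = 0.

Lemma notin_exp p r n : r \notin p -> r ^+ n \notin p.
Proof.
move=> rp; elim: n => [|n IH]; first by rewrite expr0 spec_proper.
by rewrite exprS; apply/negP => /(@spec_prime _ p)[]; apply/negP.
Qed.

Lemma pkill_prime p q M n (x : M) : {subset p <= q} -> pkill q n x -> pkill p n x.
Proof.
move=> pq; elim: n x => [//|n IH] x qx r rp; apply: IH.
by apply: qx; exact: pq.
Qed.

Lemma pkill_compat p M N N' (f : {linear M -> N}) (g : {linear M -> N'}) n :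
  (forall x, f x = 0 -> g x = 0) -> forall x, pkill p n (f x) -> pkill p n (g x).
Proof.
move=> fg; elim: n => [//|n IH] x fx r rp.
by rewrite -linear_act; apply: IH; rewrite linear_act; exact: fx.
Qed.

Lemma coprimary_sub p K K' (f : {linear K' -> K}) :
  injective f -> coprimary p K -> coprimary p K'.
Proof.
move=> fI [[n Kn] Ks]; split; first by exists n => x; exact: (pkill_inj fI).
by move=> s x sx; apply: (linear_inj0 fI); apply: (Ks s); rewrite -linear_act sx linear0.
Qed.

(** Let [p] be maximal among annihilators of nonzero elements, say that of [x0]. It is prime: the
    annihilator of a nonzero [b ** x0] contains [p], hence equals it. *)
Lemma maximal_annihilator X : (exists x : X, x <> 0) ->
  exists p, (exists2 x : X, x <> 0 & forall r, r \in p -> r ** x = 0) /\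
    forall x : X, x <> 0 -> (forall r, r \in p -> r ** x = 0) ->
      forall r, r ** x = 0 -> r \in p.
Proof.
move=> [x1 x1n0]; pose ann (x : X) : set R^o := [set r : R^o | (r : R) ** x = 0].
have annm x : submod (ann x).
  split; first by rewrite /ann /= rmorph0 scale0r.
  move=> a r s rx sx; rewrite /ann /= rmorphD rmorphM scalerDl -scalerA.
  by rewrite [_ *: x]rx [_ *: x]sx scaler0 addr0.
have accR := noeth_acc (noetherian_noeth hRL.1).
have [||_ [x0 x0n0 <-] xmax] := accR (ann @` [set x | x <> 0]).
- by exists (ann x1), x1.
- by move=> _ [x _ <-].
pose P : {pred R} := [pred r | r ** x0 == 0].
have PE r : (r \in P) = (r ** x0 == 0) by [].
have Pi : submod_closed (P : {pred R^o}).
  have [h0 hl] := annm x0; split; first by rewrite PE; apply/eqP.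
  by move=> a r s; rewrite !PE => /eqP rx /eqP sx; apply/eqP; exact: hl.
have P1 : 1 \notin P by rewrite PE rmorph1 scale1r; apply/eqP.
have Pp a b : a * b \in P -> a \in P \/ b \in P.
  rewrite !PE => /eqP ab; case: (boolP (b ** x0 == 0)) => [|/eqP bx]; first by right.
  left; apply/eqP; apply: (xmax (ann (b ** x0))); first by exists (b ** x0).
    by move=> r rx; rewrite /ann /= -scale_mapC [_ *: x0]rx scaler0.
  by rewrite /ann /= actA.
exists (Spec Pi P1 Pp); split=> [|x xn0 px r rx].
  by exists x0 => // r; rewrite /in_mem /= => /eqP.
apply/eqP; apply: (xmax (ann x)) rx; first by exists x.
by move=> s sx; apply: px; apply/eqP.
Qed.

(* The primes p maximal among the annihilators of elements of X are associated,
   and the elements killed by a power of p form a p-coprimary submodule. *)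
Lemma coprimary_submodule X : fingen X -> (exists x : X, x <> 0) ->
  exists p (N : set X) n, [/\ submod N, exists2 x, N x & x <> 0,
    forall x, N x -> pkill p n x, forall m x, pkill p m x -> N x
    & forall (s : den p) x, N x -> sval s ** x = 0 -> x = 0].
Proof.
move=> /(alg_acc hRL) accX /maximal_annihilator[p [[x0 x0n0 px0] pmax]].
pose S n := [set x : X | pkill p n x].
have [||_ [n _ <-] nmax] := accX [set S n | n in setT].
- by exists (S 0%N), 0%N.
- by move=> _ [n _ <-]; exact: submod_pkill.
(* The submodules killed by powers of [p] increase, so they are constant from the maximal one on. *)
have sS m : S m `<=` S n.
  apply: subset_trans (nmax (S (maxn m n)) _ _); last 2 first.
  - by exists (maxn m n).
  - by move=> x; apply: pkill_leq; rewrite leq_maxr.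
  by move=> x; apply: pkill_leq; rewrite leq_maxl.
exists p, (S n), n; split=> //.
- exact: submod_pkill.
- exists x0 => //; apply: (sS 1%N) => r rp; exact: px0.
(* If [s] kills a nonzero [x], it kills the multiples of [x] by [p], which vanish by induction;
   maximality of [p] then puts [s] in [p]. *)
- move=> s; elim: (n) => [//|m IH] x px sx; apply: contrapT => xn0.
  have /negP := svalP s; apply; apply: (pmax x xn0) => // r rp.
  by apply: IH; [exact: px|rewrite -scale_mapC sx scaler0].
Qed.

(** The kernel of [g] is the whole [p]-power torsion of [X]. If [q] contains [p], elements of [K]
    are killed by a power of [p], so they lift into the kernel and vanish. Otherwise, for [r] in [p]
    outside [q], multiplication by [r ^+ n] factors through [Q] and is injective on [K]. *)
Lemma coprimary_quotient X Q (g : {linear X -> Q}) p n :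
  (forall y, exists x, g x = y) -> (forall x, g x = 0 -> pkill p n x) ->
  (forall m x, pkill p m x -> g x = 0) ->
  forall q K (k : {linear K -> Q}), coprimary q K -> injective k ->
    (forall x : K, x = 0) \/ exists j : {linear K -> X}, injective j.
Proof.
move=> gS gn ng q K k [[m Km] Ks] kI.
have [pq|npq] := pselect {subset p <= q}.
  left=> y; apply: (linear_inj0 kI); have [x xE] := gS (k y).
  rewrite -xE; apply: (ng (m + n)%N); apply: (pkill_factor gn); rewrite xE.
  by apply: pkill_linear; apply: pkill_prime pq _.
have [r rp rq] : exists2 r, r \in p & r \notin q.
  apply: contrapT => h; apply: npq => r rp; apply: contrapT => /negP rq.
  by apply: h; exists r.
right; have [|h hE] := linear_factor (h := ract (r ^+ n) : {linear X -> X}) gS.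
  by move=> x /gn px; exact: pkill_exp px.
exists (h \o k : {linear K -> X}); apply: linear_inj => y /=.
have [x xE] := gS (k y); rewrite -xE hE => rx.
pose s : den q := exist _ (r ^+ n) (notin_exp n rq).
apply: (Ks s); apply: (linear_inj0 kI).
by rewrite linear_act -xE -linear_act [_ *: x]rx linear0.
Qed.

(** From a counterexample, choose a quotient [Q] satisfying [H], outside [F], with maximal kernel.
    Dividing by a coprimary submodule keeps [H] by [coprimary_quotient] and stays outside [F] by
    closure under extensions, against maximality. *)
Lemma torf_coprimary (F : lmodType L -> Prop) X : torf (@fingen L) F -> fingen X ->
  (forall p K (k : {linear K -> X}), coprimary p K -> injective k -> F K) -> F X.
Proof.
move=> [[_ F_iso F_zero] F_ext _] fgX.
pose H Q := forall p K (k : {linear K -> Q}), coprimary p K -> injective k -> F K.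
rewrite -/(H X) => HX; apply: contrapT => nFX.
pose C := [set W : set X | exists Q (g : {linear X -> Q}),
  [/\ forall y, exists x, g x = y, forall x, g x = 0 <-> W x, H Q & ~ F Q]].
have [||W [Q [g [gS gW HQ nFQ]]] Wmax] := alg_acc hRL fgX (C := C).
- exists [set 0], X, idfun; split=> // y; by exists y.
- move=> W [Q [g [_ gW _ _]]]; have -> : W = g @^-1` [set 0].
    by apply/seteqP; split=> x /gW.
  exact: submod_preim (submod_set0 Q).
have fgQ : fingen Q := fingen_quo gS fgX.
have [|p [N [n [Nm [y0 Ny0 y0n0] Nn nN Ns]]]] := coprimary_submodule fgQ.
  apply: contrapT => h; apply: nFQ; apply: F_zero => x.
  by apply: contrapT => xn0; apply: h; exists x.
have [K [k [kI kN]]] := submodule_ex Nm.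
have FK : F K.
  apply: (HQ p K k) => //; split.
    by exists n => x; apply: (pkill_inj kI); apply: Nn; apply/kN; exists x.
  move=> s x sx; apply: (linear_inj0 kI); apply: (Ns s); first by apply/kN; exists x.
  by rewrite -linear_act sx linear0.
have [Q' [h [hS hN]]] := quotient_ex Nm.
have HQ' : H Q'.
  move=> q K' k' copK' k'I.
  have [||K'0|[j jI]] := coprimary_quotient hS _ _ copK' k'I (p := p) (n := n).
  - by move=> x /hN/Nn.
  - by move=> m x /nN/hN.
  - exact: F_zero.
  - exact: (HQ q K' j copK' jI).
have nFQ' : ~ F Q'.
  move=> FQ'; apply: nFQ; apply: (F_ext K Q Q' k h) => //.
  by split=> // y; rewrite hN kN.
have CW' : C ((h \o g) @^-1` [set 0]).
  exists Q', (h \o g : {linear X -> Q'}); split=> // y.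
  by have [z <-] := hS y; have [x <-] := gS z; exists x.
have [x xE] := gS y0; apply: y0n0; rewrite -xE; apply/gW.
apply: (Wmax _ CW'); last by rewrite /preimage /= xE; apply/hN.
by move=> z /gW gz; rewrite /preimage /= gz linear0.
Qed.

Section AtPrime.
Variable p : spec R.

Lemma coprimary_finite_length K : fingen K -> coprimary p K -> finite_length (loc p K).
Proof.
move=> fgK [[n Kn] _].
exact: (generating_finite_length hRL fgK (frac_locmap p K).1 Kn).
Qed.

Lemma frac_map_inj K : coprimary p K ->
  injective (@frac_map R L p K).
Proof.
by move=> [_ Ks]; apply: linear_inj => x /frac_eq0[s]; exact: Ks.
Qed.

Lemma loc_zero X : (forall x : X, x = 0) -> forall z : loc p X, z = 0.
Proof.
move=> X0 z; have [x [s ->]] := fracP z.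
by rewrite frac_divden (X0 x) !linear0.
Qed.

Lemma loc_exact X M N (f : {linear X -> M}) (g : {linear M -> N}) :
  short_exact f g ->
  exists (f' : {linear loc p X -> loc p M}) (g' : {linear loc p M -> loc p N}),
    short_exact f' g'.
Proof.
move=> [fI gS gf].
have [f' f'E] := loc_map_ex (@frac_map R L p M \o f).
have [g' g'E] := loc_map_ex (@frac_map R L p N \o g).
exists f', g'; split.
- apply: linear_inj => z; have [x [s ->]] := fracP z.
  rewrite f'E /= => e; have : frac_map p (f x) = 0.
    by rewrite -[LHS](divdenKV s) e scaler0.
  move=> /frac_eq0[t tfx]; rewrite frac_divden.
  rewrite (_ : frac_map p x = 0) ?linear0 //; apply/frac_eq0; exists t.
  by apply: fI; rewrite linear_act linear0.
- move=> z; have [y [s ->]] := fracP z; have [x <-] := gS y.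
  by exists (frac x s); rewrite g'E frac_divden.
- move=> z; split=> [|[w <-]]; last first.
    have [x [s ->]] := fracP w; rewrite f'E /= -frac_divden g'E /=.
    by rewrite (_ : g (f x) = 0) ?linear0 //; apply/gf; exists x.
  have [y [s ->]] := fracP z; rewrite g'E /= => e.
  have : frac_map p (g y) = 0 by rewrite -[LHS](divdenKV s) e scaler0.
  move=> /frac_eq0[t]; rewrite -linear_act => /gf[x xE].
  exists (frac x (den_mul t s)); rewrite f'E /= -frac_divden xE.
  exact: frac_cancel.
Qed.

(** [J] is [u] times [I], where [u] kills all that some denominator kills. So denominators act
    injectively on [J], and multiplication by [u] becomes invertible after localization. *)
Lemma coprimary_bounded I : acc I -> (exists n, forall x : I, pkill p n x) ->
  exists J (j : {linear J -> I}), [/\ coprimary p J, injective j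
    & isomorphic (loc p I : lmodType (loc_ring L p)) (loc p J)].
Proof.
move=> accI [n In]; have [u uE] := torsion_bounded p accI.
have [J [h [j [hS jI jh]]]] := image_ex (ract (sval u) : {linear I -> I}).
exists J, j; split=> //; first split.
- by exists n => x; exact: (pkill_inj jI).
- move=> s x sx; have [z zE] := hS x; apply: (linear_inj0 jI).
  rewrite -zE jh; apply: (uE _ (den_mul s u)) => /=.
  by rewrite -actA -[X in _ ** X]/(ract _ _) -jh zE -linear_act sx linear0.
- apply/loc_isoP; exists (@frac_map R L p J \o h); split.
    move=> y; have [s [x xE]] := (frac_locmap p J).1 y.
    by have [z zE] := hS x; exists s, z; rewrite /= zE.
  move=> x /frac_eq0[s sx]; exists (den_mul s u) => /=.
  by rewrite -actA -[X in _ ** X]/(ract _ _) -jh -linear_act sx linear0.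
Qed.

End AtPrime.
End Coprimary.

(** * The maps of the square, and the inverse on torsionfree families *)

Section Classification.
Variables (R : comPzRingType) (L : algebra R).
Hypothesis hRL : noetherian_algebra L.
Implicit Types (M N X K Q I J : lmodType L) (p q : spec R)
  (C T F : lmodType L -> Prop) (G : family L).

Local Notation "r ** x" := (alg_map L r *: x) (at level 40, left associativity).
Local Notation torsL := (tors (@fingen L)).
Local Notation torfL := (torf (@fingen L)).
Local Notation flat p := (@finite_length (loc_ring L p)).

Lemma subcategory_Phi C p : subcategory (@fingen L) C ->
  subcategory (flat p) (@Phi R L C p).
Proof.
move=> [_ _ C0]; split.
- by move=> Y [].
- move=> Y Z YZ [[X [CX XY]] flY]; split; last exact: finite_length_iso flY.
  by exists X; split=> //; exact: isomorphic_trans YZ.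
- move=> Y Y0; split; last exact: finite_length_zero.
  have [Z Z0] := zero_module_ex L; exists Z; split; first exact: C0.
  have [h _] := linear_ex (h := fun _ : loc p Z => 0 : Y)
    (fun a x y => esym (etrans (addr0 _) (scaler0 _ a))).
  apply: (isomorphicP (f := h)); last by move=> y; exists 0; rewrite linear0 [y]Y0.
  by move=> x y _; rewrite (loc_zero Z0 x) (loc_zero Z0 y).
Qed.

(** For extensions, a generating submodule of [Y] lying in [T] is built from those for [Z] and [X].
    Generators of the first are lifted to [Y]; the second is divided by a denominator so as to
    contain what the span of the lifts has in common with [X]. *)
Lemma tors_Phi T : torsL T -> TT (Phi T).
Proof.
move=> [Tsub T_ext T_quo] p; have [T_fg _ _] := Tsub.
split; first exact: subcategory_Phi.
- move=> X Y Z f g flY [fI gS gf] [TX flX] [TZ flZ]; split=> //.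
  have [X0 [a [TX0 aG]]] := tors_class_generating TX.
  have [Z0 [c [TZ0 cG]]] := tors_class_generating TZ.
  have [f' f'E] := linear_restr (loc_map p) f.
  have [g' g'E] := linear_restr (loc_map p) g.
  have [I [ic [i [icS iI icE]]]] := image_ex c.
  have fgI : fingen I := fingen_quo icS (T_fg _ TZ0).
  have TI : T I by exact: T_quo TZ0.
  have [w wE] := (fingenP _).1 fgI.
  have /choice[l lE] z : exists y, g' y = i z.
    by have [y yE] := gS (i z); exists y; rewrite g'E.
  have [Y1 [b [bI bE]]] := submodule_ex (submod_lspan (map l w)).
  have fgY1 : fingen Y1.
    apply: (fingen_range (s := map l w) bI).
    by apply/seteqP; split=> [y [x _ <-]|y /bE[x <-]]; [apply/bE; exists x|exists x].
  have accY1 := alg_acc hRL fgY1.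
  have [K1 [k1 [k1I k1E]]] := kernel_ex (g' \o b : {linear Y1 -> restr (loc_map p) Z}).
  have [v vE] := (fingenP _).1 (fingen_acc k1I accY1).
  (* [K1] is the part of the lifted span [Y1] coming from [X]; one denominator [u] moves all of it
     into the image of [X0]. *)
  have [||u uE] := @den_uniform R L p K1 ((b \o k1) @^-1` range (f' \o a)) v.
  + exact: submod_preim (submod_image _ (submod_setT X0)).
  + move=> y _; have /k1E : exists z, k1 z = k1 y by exists y.
    move=> /=; rewrite g'E => /gf[x xE]; have [s [z zE]] := aG x.
    exists s; exists z => //; transitivity (sval s ** b (k1 y)).
      by rewrite /= zE linear_act f'E xE.
    by rewrite /= !linear_act.
  pose d := divden u \o (f' \o a) : {linear X0 -> restr (loc_map p) Y}.
  pose W := [set y : restr (loc_map p) Y | exists y1 x, [/\ range b y1, range d x & y = y1 + x]].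
  have Wm : submod W.
    by apply: submod_add; exact: submod_image (submod_setT _).
  have [Y0 [e [eI eE]]] := submodule_ex Wm.
  have [x|d' d'E] := linear_lift (h := d) eI.
    apply/eE; exists 0, (d x); rewrite add0r; split=> //.
    by exists 0; rewrite ?linear0.
  have gd x : g' (d x) = 0.
    rewrite /d /= (_ : divden u (f' (a x)) = f' (divden u (a x))).
      by rewrite g'E; apply/gf; rewrite f'E; exists (divden u (a x)).
    by apply: divden_eq; rewrite -linear_act divdenKV.
  have gb y : range i (g' (b y)).
    have : lspan (map l w) (b y) by apply/bE; exists y.
    apply: (lspan_min (W := g' @^-1` range i)) => [|_ /mapP[z _ ->]].
      exact: submod_preim (submod_image _ (submod_setT _)).
    by exists z; rewrite ?lE.
  have [x|h hE] := linear_lift (h := g' \o e : {linear Y0 -> restr (loc_map p) Z}) iI.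
    have /eE[_ [_ [[y _ <-] [z _ <-] xE]]] : exists x', e x' = e x by exists x.
    by rewrite /= xE linearD gd addr0; have [z' _ <-] := gb y; exists z'.
  have hS z : exists y, h y = z.
    suff [y0 _ <-] : range h z by exists y0.
    have : lspan w z by rewrite wE.
    apply: (lspan_min (W := range h)) => [|x xw].
      exact: submod_image (submod_setT _).
    have [y1 y1E] : exists y1, b y1 = l x by apply/bE; apply: mem_lspan; exact: map_f.
    have [y0 y0E] : exists y0, e y0 = l x.
      apply/eE; exists (b y1), 0; rewrite addr0; split=> //.
      by exists 0; rewrite ?linear0.
    by exists y0 => //; apply: iI; rewrite hE /= y0E lE.
  have [D [dp [di [dpS diI diE]]]] := image_ex d'.
  have hs : short_exact di h.
    split=> // y0; split=> [hy0|[x <-]]; last first.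
      have [x0 <-] := dpS x; apply: (linear_inj0 iI).
      by rewrite hE /= diE d'E gd.
    have /eE[_ [_ [[y1 _ <-] [x _ <-] y0E]]] : exists x', e x' = e y0 by exists y0.
    have : (g' \o b) y1 = 0.
      by have := hE y0; rewrite hy0 linear0 /= y0E linearD gd addr0 => <-.
    (* The choice of [u] enters here: the contribution of [Y1] to a kernel element lies in [K1],
       hence in the image of [d]. *)
    move=> /k1E[z zE]; have [|x' _ x'E] := uE z; first by rewrite vE.
    exists (dp (x' + x)); rewrite diE; apply: eI; rewrite d'E y0E linearD.
    congr (_ + _); apply: divden_eq; rewrite [LHS]x'E /=.
    by rewrite !linear_act zE.
  have fgD : fingen D := fingen_quo dpS (T_fg _ TX0).
  have fgY0 : fingen Y0 := fingen_ext hs fgD fgI.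
  have TY0 : T Y0 by apply: T_ext hs _ TI => //; exact: T_quo TX0.
  apply: (generating_class (f := e)) => // y.
  have [s [z zE]] := cG (g y); have [y0 y0E] := hS (ic z).
  have /gf[x xE] : g (sval s ** (y : restr (loc_map p) Y) - e y0) = 0.
    rewrite -g'E linearB linear_act g'E -zE -icE -y0E hE /=.
    by rewrite subrr.
  have [t [x0 x0E]] := aG x.
  (* Since [s] times [y] is [e y0] plus [f x], and [t] times [x] is [a x0]; the factor [u] cancels
     the division in [d]. *)
  exists (den_mul t s), (sval t ** y0 + sval u ** d' x0).
  rewrite linearD !linear_act d'E /d /= divdenKV x0E linear_act f'E xE.
  by rewrite scalerBr addrC subrK actA.
- move=> X Y g flY gS [TX flX]; split=> //.
  have [X0 [a [TX0 aG]]] := tors_class_generating TX.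
  have [g' g'E] := linear_restr (loc_map p) g.
  apply: (generating_class (f := g' \o a : {linear X0 -> restr (loc_map p) Y})) => //.
    exact: T_fg.
  move=> y; have [x <-] := gS y; have [s [z zE]] := aG x.
  by exists s, z; rewrite /= zE linear_act g'E.
Qed.

(** By [torf_classP] it suffices to test finitely generated [K] over [L]. In an extension, [K] in
    [Y] is an extension of its image in [Z] by its part in [X]. *)
Lemma torf_Phi F : torfL F -> FF (Phi F).
Proof.
move=> hF p; have [Fsub F_ext F_sub] := hF.
have Lacc := alg_acc hRL.
split; first exact: subcategory_Phi.
- move=> X Y Z f g flY [fI gS gf] [FX flX] [FZ flZ]; split=> //.
  apply/(torf_classP Lacc hF (finite_length_fingen flY)) => K k fgK kI.
  have [f' f'E] := linear_restr (loc_map p) f.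
  have [g' g'E] := linear_restr (loc_map p) g.
  have [K1 [k1 [k1I k1E]]] := kernel_ex (g' \o k : {linear K -> restr (loc_map p) Z}).
  have [I [h [i [hs iI ih]]]] := short_exact_image k1I k1E.
  have f'I : injective f' by move=> x y; rewrite !f'E => /fI.
  have [x|l lE] := linear_lift (h := k \o k1 : {linear K1 -> restr (loc_map p) Y}) f'I.
    have /k1E /= : exists y, k1 y = k1 x by exists x.
    by rewrite g'E => /gf[z zE]; exists z; rewrite f'E.
  have accK := Lacc _ fgK.
  apply: (F_ext K1 K I k1 h) => //.
    apply: ((torf_classP Lacc hF (finite_length_fingen flX)).1 FX K1 l).
      exact: fingen_acc k1I accK.
    by move=> x y e; apply: k1I; apply: kI; rewrite -[LHS]lE -[RHS]lE e.
  apply: ((torf_classP Lacc hF (finite_length_fingen flZ)).1 FZ I i) => //.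
  by apply: fingen_quo fgK; case: hs.
- move=> X Y f flX fI [FY flY]; split=> //.
  apply/(torf_classP Lacc hF (finite_length_fingen flX)) => K k fgK kI.
  have [f' f'E] := linear_restr (loc_map p) f.
  apply: ((torf_classP Lacc hF (finite_length_fingen flY)).1 FY K
    (f' \o k : {linear K -> restr (loc_map p) Y}) fgK).
  by move=> x y; rewrite /= !f'E => /fI/kI.
Qed.

Lemma perp_torfL C : torfL (perp (@fingen L) C).
Proof.
by apply: perp_torf; [exact: @fingen_quo|exact: fingen_zero].
Qed.

Lemma perp_torf_fl p B : torf (flat p) (perp (flat p) B).
Proof.
by apply: perp_torf; [exact: @finite_length_quo|exact: finite_length_zero].
Qed.

(** A map into [Y] from a localized torsion object vanishes once it does so on a generating [X] in
    [T], whose image in [Y] is finitely generated, hence in the perpendicular class. Conversely, the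
    image of a map from [T] to [K] generates a subobject of [Y] in the localized class, whose
    inclusion is zero. *)
Lemma Phi_perp T : torsL T ->
  Phi (perp (@fingen L) T) = family_perp (Phi T).
Proof.
move=> [[T_fg _ _] T_ext T_quo]; apply: functional_extensionality_dep => p.
apply: funext => Y; apply: propext; have Lacc := alg_acc hRL.
split=> [[PY flY]|[flY PY]]; split=> //.
  have hP := (torf_classP Lacc (perp_torfL T) (finite_length_fingen flY)).1 PY.
  move=> M [TM flM] f; have [X [a [TX aG]]] := tors_class_generating TM.
  have [f' f'E] := linear_restr (loc_map p) f.
  have [I [h [i [hS iI ih]]]] := image_ex (f' \o a : {linear X -> restr (loc_map p) Y}).
  have [_ /(_ X TX h) h0] := hP I i (fingen_quo hS (T_fg _ TX)) iI.
  move=> m; have [s [x xE]] := aG m; rewrite -f'E; apply: (den_inj (s := s)).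
  by rewrite -linear_act -xE -[f' _]ih h0 linear0.
apply/(torf_classP Lacc (perp_torfL T) (finite_length_fingen flY)) => K k fgK kI.
split=> // M TM g m.
pose W : set Y := [set y : restr (loc_map p) Y |
  exists s : den p, range (k \o g) (sval s ** y)].
have Wm : submod W.
  have Im := submod_image (k \o g : {linear M -> restr (loc_map p) Y}) (submod_setT M).
  apply/submod_locP; split.
    split; first by exists den1; rewrite scaler0; exact: Im.1.
    move=> a x y [s Wx] [t Wy]; exists (den_mul s t) => /=.
    rewrite scalerDr -scale_mapC /= -[in X in _ + X]actA mulrC -actA.
    by apply: Im.2; [exact: submodZ|exact: submodZ].
  by move=> s y [t]; rewrite actA => Wy; exists (den_mul t s).
have [S [i [iI iE]]] := submodule_ex Wm.
have [i' i'E] := linear_restr (loc_map p) i.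
have i'I : injective i' by move=> x y; rewrite !i'E => /iI.
have [x|h hE] := linear_lift (h := k \o g : {linear M -> restr (loc_map p) Y}) i'I.
  have /iE[y yE] : W (k (g x)).
    by exists den1; exists x => //; rewrite rmorph1 scale1r.
  by exists y; rewrite i'E.
have TS : @Phi R L T p S.
  split; last exact: finite_length_sub iI flY.
  apply: (generating_class (f := h)) => //; first exact: T_fg.
  move=> y; have /iE[s [x _ xE]] : exists z, i z = i y by exists y.
  exists s, x; apply: i'I; rewrite hE linear_act i'E; exact: xE.
apply: (linear_inj0 kI); rewrite -[k _]hE i'E; exact: PY TS i _.
Qed.

Lemma Phi_le C C' : class_le C C' -> family_le (Phi C) (Phi C').
Proof. by move=> CC p Y [[X [/CC CX XY]] flY]; split=> //; exists X. Qed.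

(** Membership in [F'] is tested on coprimary submodules [K]: their localization has finite length,
    so the hypothesis applies to it, and [K] embeds in it. *)
Lemma Phi_torf_reflect F F' : torfL F -> torfL F' ->
  family_le (Phi F) (Phi F') -> class_le F F'.
Proof.
move=> hF hF' le X FX; have [[F_fg _ _] _ F_sub] := hF.
apply: (torf_coprimary hRL hF') => [|p K k copK kI]; first exact: F_fg.
have fgK := fingen_acc kI (alg_acc hRL (F_fg _ FX)).
have flK := coprimary_finite_length hRL fgK copK.
have [|] := le p (loc p K).
  by split=> //; exists K; split; [exact: F_sub kI FX|exact: isomorphic_refl].
move=> /(torf_classP (alg_acc hRL) hF' (finite_length_fingen flK)) h _.
exact: (h K (@frac_map R L p K) fgK (frac_map_inj copK)).
Qed.

Definition glue G : lmodType L -> Prop := fun X => fingen X /\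
  forall p K (k : {linear K -> X}), coprimary p K -> injective k -> G p (loc p K).

(** For extensions, the image in [Z] of a coprimary [K] is killed by a power of [p] but may fail to
    be coprimary; [coprimary_bounded] replaces it by a submodule with isomorphic localization. *)
Lemma torf_glue G : FF G -> torfL (glue G).
Proof.
move=> hG; split; first split.
- by move=> X [].
- move=> X Y XY [fgX GX]; split; first exact: fingen_iso fgX.
  move=> p K k copK kI; have [f /bij_inj fI] := isomorphic_sym XY.
  by apply: (GX p K (f \o k : {linear K -> X})) => //; exact: inj_comp.
- move=> X X0; split=> [|p K k _ kI]; first exact: fingen_zero.
  have [[_ _ G0] _ _] := hG p; apply: G0; apply: loc_zero => x.
  by apply: kI; rewrite (X0 (k x)) (X0 (k 0)).
- move=> X Y Z f g fgY [fI gS gf] [fgX GX] [fgZ GZ]; split=> // p K k copK kI.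
  have [[_ G_iso _] G_ext _] := hG p.
  have accK := acc_sub kI (alg_acc hRL fgY).
  have [K1 [k1 [k1I k1E]]] := kernel_ex (g \o k : {linear K -> Z}).
  have [I [h [i [hs iI ih]]]] := short_exact_image k1I k1E.
  have [x|l lE] := linear_lift (h := k \o k1 : {linear K1 -> Y}) fI.
    have /k1E /= : exists y, k1 y = k1 x by exists x.
    by move=> /gf.
  have hS : forall y, exists x, h x = y by case: hs.
  have [n Kn] := copK.1.
  have [|J [j [copJ jI IJ]]] := coprimary_bounded (p := p) (acc_quo hS accK).
    by exists n => y; have [x <-] := hS y; exact: pkill_linear.
  have [f' [g' hs']] := loc_exact p hs.
  apply: (G_ext _ _ _ f' g') => //.
  + exact: (coprimary_finite_length hRL (noeth_fingen (acc_noeth accK)) copK).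
  + apply: (GX p K1 l); first exact: coprimary_sub k1I copK.
    by move=> x y e; apply: k1I; apply: kI; rewrite -[LHS]lE -[RHS]lE e.
  + apply: (G_iso (loc p J)); first exact: isomorphic_sym.
    by apply: (GZ p J (i \o j : {linear J -> Z})) => //; exact: inj_comp.
- move=> X Y f fgX fI [fgY GY]; split=> // p K k copK kI.
  by apply: (GY p K (f \o k : {linear K -> Y})) => //; exact: inj_comp.
Qed.

Lemma coprimary_disjoint p q X K (k : {linear K -> X}) n r :
  (forall x : X, pkill p n x) -> coprimary q K -> injective k ->
  r \in p -> r \notin q -> forall x : K, x = 0.
Proof.
move=> Xn [_ Ks] kI rp rq x; pose s : den q := exist _ (r ^+ n) (notin_exp n rq).
by apply: (Ks s); apply: (linear_inj0 kI); rewrite linear_act; exact: pkill_exp rp (Xn _).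
Qed.

Lemma spec_eq p q : {subset p <= q} -> {subset q <= p} -> p = q.
Proof.
case: p q => P i1 p1 h1 [Q i2 p2 h2] /= pq qp.
have e : P = Q by apply: funext => x; apply/idP/idP; [exact: pq|exact: qp].
by case: _ / e i2 p2 h2 {pq qp} => i2 p2 h2; congr Spec; exact: Prop_irrelevance.
Qed.

(** If [Y] of finite length is the localization of [X], a suitable denominator [u] makes [u] times
    [X] coprimary, still with localization [Y]. Conversely, nonzero coprimary submodules of a
    lattice in [Y] belong to [p], and their localizations embed into [Y]. *)
Lemma Phi_glue G : FF G -> Phi (glue G) = G.
Proof.
move=> hG; apply: functional_extensionality_dep => p.
apply: funext => Y; apply: propext; have [[G_fl G_iso G0] _ G_sub] := hG p.
split=> [[/loc_classP[X [f [[fgX GX] [fG f0]]]] flY]|GY].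
  have [n Yn] := finite_length_pkill hRL flY.
  have [u uE] := torsion_bounded p (alg_acc hRL fgX).
  have uf x : f x = 0 -> ract (sval u) x = 0 by move=> /f0[s]; exact: uE.
  have [K [h [k [hS kI hk]]]] := image_ex (ract (sval u) : {linear X -> X}).
  have copK : coprimary p K.
    split; first exists n.
      move=> x; have [z <-] := hS x; apply: (pkill_inj kI); rewrite hk.
      exact: (pkill_compat (f := f) uf).
    move=> s x sx; have [z zE] := hS x; apply: (linear_inj0 kI).
    rewrite -zE hk; apply: (uE _ (den_mul s u)) => /=.
    by rewrite -actA -[X in _ ** X]/(ract _ _) -hk zE -linear_act sx linear0.
  apply: (G_iso (loc p K)); last exact: GX kI.
  apply/loc_isoP; exists (f \o k); split.
    move=> y; have [s [x xE]] := fG y; exists (den_mul u s), (h x).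
    by rewrite /= hk [f _]linear_act xE actA.
  by move=> x /= /f0[s sx]; exists s; apply: (linear_inj0 kI); rewrite linear_act.
have flY := G_fl _ GY; split=> //.
have [n Yn] := finite_length_pkill hRL flY.
have [K [k [fgK kI kG]]] := lattice_ex (finite_length_fingen flY).
have Kn (x : K) : pkill p n x by exact: (pkill_inj kI).
apply: (locmap_class (X := K) (f := k)); last exact: inj_locmap.
split=> // q K' j copK' jI.
have [K'0|nK'0] := pselect (forall x : K', x = 0).
  by have [[_ _ Gq0] _ _] := hG q; apply: Gq0; exact: loc_zero.
have [m K'm] := copK'.1.
have epq : p = q.
  (* An element of one prime outside the other would act both nilpotently and injectively on
     [K']. *)
  apply: spec_eq => r rp; apply: contrapT => /negP rq; apply: nK'0.
    exact: coprimary_disjoint Kn copK' jI rp rq.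
  move=> x; pose s : den p := exist _ (r ^+ m) (notin_exp m rq).
  apply: (linear_inj0 jI); apply: (linear_inj0 kI); apply: (den_inj (s := s)).
  by rewrite /= -!linear_act (pkill_exp rp (K'm x)) !linear0.
case: _ / epq copK' {K'm} => copK'.
have [h hE] := loc_map_ex (k \o j : {linear K' -> restr (loc_map p) Y}).
have fgK' := fingen_acc jI (alg_acc hRL fgK).
apply: (G_sub _ _ h) => //; first exact: coprimary_finite_length.
apply: linear_inj => z; have [x [s ->]] := fracP z; rewrite hE /= => e.
rewrite frac_divden (_ : x = 0) ?linear0 //; apply: jI; apply: kI.
by rewrite !linear0 -[LHS](divdenKV s) e scaler0.
Qed.

End Classification.

Theorem theorem1p1 (R : comPzRingType) (L : algebra R)
    (hRL : noetherian_algebra L) :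
  let tors_mod := tors (@fingen L) in
  let torf_mod := torf (@fingen L) in
  let perp_mod := perp (@fingen L) in
  (* the four maps are well defined *)
  [/\ maps_into tors_mod (@TT R L) (@Phi R L),
      maps_into torf_mod (@FF R L) (@Phi R L),
      maps_into tors_mod torf_mod perp_mod
    & maps_into (@TT R L) (@FF R L) (@family_perp R L)] /\
  (* the square commutes *)
  (forall T, tors_mod T -> Phi (perp_mod T) = family_perp (Phi T)) /\
  [/\ order_embedding tors_mod (@TT R L) (@class_le L) (@family_le R L)
        (@Phi R L),
      order_anti_embedding tors_mod torf_mod (@class_le L) (@class_le L)
        perp_mod,
      order_isomorphism torf_mod (@FF R L) (@class_le L) (@family_le R L)
        (@Phi R L)
    & order_anti_isomorphism (@TT R L) (@FF R L) (@family_le R L)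
        (@family_le R L) (@family_perp R L)].
Proof.
move=> tors_mod torf_mod perp_mod.
have PhiT : maps_into tors_mod (@TT R L) (@Phi R L) by exact: tors_Phi.
have PhiF : maps_into torf_mod (@FF R L) (@Phi R L) by exact: torf_Phi.
have perpL : maps_into tors_mod torf_mod perp_mod by move=> T _; exact: perp_torfL.
have perpF : maps_into (@TT R L) (@FF R L) (@family_perp R L).
  by move=> G _ p; exact: perp_torf_fl.
have square := Phi_perp hRL.
have perp_reflL T T' : tors_mod T -> tors_mod T' ->
    class_le (perp_mod T') (perp_mod T) -> class_le T T'.
  apply: perp_reflect.
  - by move=> M N f fI fgN; exact: fingen_acc fI (alg_acc hRL fgN).
  - exact: @fingen_quo.
  - exact: alg_acc.
have perp_reflF (G G' : family L) : TT G -> TT G' ->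
    family_le (family_perp G') (family_perp G) -> family_le G G'.
  move=> hG hG' le p; apply: perp_reflect (hG p) (hG' p) (le p).
  - exact: @finite_length_sub.
  - exact: @finite_length_quo.
  - by move=> M /finite_length_chain[].
have family_perp_anti (G G' : family L) : family_le G G' -> family_le (family_perp G') (family_perp G).
  by move=> GG p; exact: perp_anti.
have class_eq T T' : class_le T T' -> class_le T' T -> T = T' :> (lmodType L -> Prop).
  by move=> h h'; apply: funext => M; apply: propext; split=> [/h|/h'].
have family_eq (G G' : family L) : family_le G G' -> family_le G' G -> G = G'.
  move=> h h'; apply: functional_extensionality_dep => p.
  by apply: funext => M; apply: propext; split=> [/h|/h'].
have Phi_reflF := Phi_torf_reflect hRL.
split=> //; split=> //; split.
- split=> // [T T' _ _|T T' hT hT' le]; first exact: Phi_le.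
  (* Both reflections reduce the goal to the images under [Phi] of the perpendicular classes; the
     square turns these into perpendiculars of families, where [le] applies. *)
  apply: perp_reflL => //; apply: Phi_reflF; [exact: perpL|exact: perpL|].
  by rewrite !square //; exact: family_perp_anti.
- by split=> // T T' _ _; exact: perp_anti.
- split; split=> //.
  + move=> F F' hF hF' e; apply: class_eq; apply: Phi_reflF => //; rewrite e => p M //.
  + by move=> G hG; exists (glue G); split; [exact: torf_glue|exact: Phi_glue].
  + by move=> F F' _ _; exact: Phi_le.
- split; split=> //.
  + by move=> G G' hG hG' e; apply: family_eq; apply: perp_reflF => //; rewrite e => p M.
  + move=> G hG.
    (* [perp_surj] applies at each prime because finite length gives the descending condition; the
       components are chosen independently. *)
    have h p : exists T, tors (@finite_length (loc_ring L p)) T /\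
        perp (@finite_length (loc_ring L p)) T = G p.
      apply: perp_surj (hG p).
      * exact: @finite_length_sub.
      * exact: @finite_length_quo.
      * exact: finite_length_zero.
      * by move=> M /finite_length_chain[].
    exists (fun p => sval (cid (h p))); split.
      by move=> p; case: cid => T [].
    by apply: functional_extensionality_dep => p; rewrite /family_perp; case: cid => T [].
  + by move=> G G' _ _; exact: family_perp_anti.
Qed.
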